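(* Consider the extended bottleneck model with charging of plug-in electric vehicles described in the context. Given a monetary budget $M_\$\le M_\$^*$, the optimal incentive (i.e. the discount minimising the total system travel time $\Gamma$ subject to the budget $M_\$$) is, for $t\in[0,N/s]$, $$p(t)=\begin{cases}0, & t\in(t^\ell,t^r),\\ \alpha-\frac{g(t)}{\bar\delta}+\sqrt{\left(\frac{g(t)}{\bar\delta}-\alpha\right)^2-\alpha^2}, & \text{otherwise,}\end{cases}\qquad g(t):=\begin{cases}\beta(t-t^\ell), & t\le t^\ell,\\ \gamma(t^r-t), & t\ge t^r,\end{cases}$$ where $$t^\ell=\sqrt{\frac{2\gamma f^{-1}(M_\$)}{s\beta(\beta+\gamma)}},\qquad t^r=\frac Ns-\sqrt{\frac{2\beta f^{-1}(M_\$)}{s\gamma(\beta+\gamma)}} .$$ The associated departure rate attained at equilibrium is $$r(t)=\begin{cases}s, & t\in[0,t^\ell]\cup[t^r,N/s],\\ \alpha s/(\alpha-\beta), & t\in(t^\ell,t''],\\ \alpha s/(\alpha+\gamma), & t\in(t'',t^r),\end{cases}\qquad\text{with}\quad t''=t'+\frac1\alpha\sqrt{\frac{2\beta\gamma f^{-1}(M_\$)}{s(\beta+\gamma)}} .$$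
   Context: Bottleneck model. $N$ homogeneous commuters (treated as a continuum of total mass $N$) enter a single bottleneck of constant capacity $s>0$ during the period $[0,N/s]$ with departure rate $r(t)\ge 0$, $\int_0^{N/s}r(t)\,dt=N$. The queue is $Q(t)=\int_{\hat t}^t r(\tau)\,d\tau-s(t-\hat t)$, where $\hat t<t$ is the last moment with $Q(\hat t)=0$ (initially there is no queue); vehicles leave first-in-first-out, and a commuter entering at time $t$ waits $T^{\mathrm v}(t)=Q(t)/s$. Fixed (congestion-free) travel times are taken to be $0$, so a commuter entering at $t$ reaches the destination at $t+T^{\mathrm v}(t)$. All commuters have the same desired arrival time $t^*$; the time origin is such that $t^*=\frac{\gamma N}{s(\beta+\gamma)}$. The unit costs of travel/waiting time, early arrival and late arrival are $\alpha,\beta,\gamma>0$, with $\beta<\alpha<\gamma$. The travel cost of entering at $t$ is $$\hat C(t)=\alpha T^{\mathrm v}(t)+\max\big(\beta d(t),-\gamma d(t)\big),\qquad d(t)=t^*-t-T^{\mathrm v}(t).$$ Charging. Each vehicle must charge for a total of $\bar\delta>0$ time units before entering the bottleneck. A commuter entering the bottleneck at $t$ charges for $\delta\in[0,\bar\delta]$ time units at a charging station during $[t-\delta,t]$, where the price is discounted by $p(t)\ge 0$ from the fixed price $\bar p$ (the discount depends on the time $t$ of entering the bottleneck), and for the remaining $\bar\delta-\delta$ at home at price $\bar p$. The discount perceived at time $\tau\in[t-\delta,t]$ is $\hat p(\tau,t)=-\frac{p(t)}{\bar\delta}\tau+\frac{p(t)}{\bar\delta}(t-\delta+\bar\delta)$.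 The charging cost is $$C_{\mathrm{ch}}(t,\delta)=\alpha\delta+(\bar\delta-\delta)\bar p+\int_{t-\delta}^t\big(\bar p-\hat p(\tau,t)\big)\,d\tau,$$ minimised over $\delta\in[0,\bar\delta]$ by $\delta^*(t)=\max\{(1-\alpha/p(t))\bar\delta,\,0\}$ (equal to $0$ if $p(t)=0$). With $\delta=\delta^*(t)$ it is $C_{\mathrm{ch}}(t)=-\frac{\bar\delta}{2p(t)}(p(t)-\alpha)^2+\bar\delta\bar p$ if $p(t)\ge\alpha$, and $C_{\mathrm{ch}}(t)=\bar\delta\bar p$ otherwise. Commuters use $\delta^*$, so the total cost of entering at $t$ is $C(t)=\hat C(t)+C_{\mathrm{ch}}(t)$. Equilibrium. Commuters are rational and choose $t$ to minimise $C(t)$. Given a discount $p$, the departure rate $r$ is at equilibrium when all commuters experience the same total cost, i.e. $C(t)=C_e$ for all $t\in[0,N/s]$, for a constant $C_e$. Travel time and budgets (evaluated at equilibrium). The total system travel time is $\Gamma=\int_0^{N/s}T^{\mathrm v}(t)\,dt$. The monetary budget used by $p$ is $M_\$=\int_0^{N/s}r(\tau)\,\delta^*(\tau)\,p(\tau)\,d\tau$; the perceived budget is $M_{\mathrm{per}}=-\int_0^{N/s}r(\tau)\,(C_{\mathrm{ch}}(\tau)-\bar\delta\bar p)\,d\tau$. The budget $M_\$^*$, which is the one required to eliminate congestion completely when the budget is unlimited, is given by $$M_\$^*=\frac{\beta\gamma N^2}{2s(\beta+\gamma)}+s\int_0^{N/s}\frac{p^*(\tau)^2-\alpha^2}{2p^*(\tau)}\,d\tau,\qquad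 p^*(t)=\alpha-\frac{h(t)}{\bar\delta}+\sqrt{\Big(\frac{h(t)}{\bar\delta}-\alpha\Big)^2-\alpha^2},$$ with $h(t)=\beta(t-t^* )$ for $t<t^*$ and $h(t)=\gamma(t^*-t)$ otherwise. The function $f$. The map $f$ gives the monetary budget in terms of the perceived budget, $M_\$=f(M_{\mathrm{per}})$, and is defined as follows. For $0\le m\le M_{\mathrm{per}}^*:=\frac{\beta\gamma N^2}{2s(\beta+\gamma)}$ put $\ell(m)=\sqrt{\frac{2\gamma m}{s\beta(\beta+\gamma)}}$ and $\rho(m)=\frac Ns-\sqrt{\frac{2\beta m}{s\gamma(\beta+\gamma)}}$. Then $$f(m)=m+\frac s2\left[\frac{\bar\delta}{\beta}\int_\alpha^{\alpha+\frac{\beta}{\bar\delta}\ell(m)}2\sqrt{y^2-\alpha^2}\,dy+\frac{\bar\delta}{\gamma}\int_\alpha^{\alpha+\frac{\gamma}{\bar\delta}\left(\frac Ns-\rho(m)\right)}2\sqrt{z^2-\alpha^2}\,dz\right],$$ and $f^{-1}$ is its inverse on $[0,M_\$^*]$. The time $t'$ is the time at which a commuter must enter the bottleneck to arrive exactly at $t^*$ (i.e. $t'+T^{\mathrm v}(t')=t^*$) in the equilibrium with no incentive ($p\equiv 0$); $t''$ is the analogous time in the equilibrium under the discount $p$.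
   Formalization: The second summands of f and of M_$^* carry an extra factor δ̄, without which they differ from the money spent unless δ̄=1 (for δ̄>1 the stated p would exceed the budget). Optimal p is unique up to discounts not above α, which have no effect. *)

(* Defs.v *)
(* MathComp-Analysis; reals are an arbitrary [R : realType], integrals are
   Lebesgue integrals. *)
From HB Require Import structures.
From mathcomp Require Import all_boot all_order all_algebra.
From mathcomp Require Import all_classical all_reals all_analysis.

Set Implicit Arguments.
Unset Strict Implicit.
Unset Printing Implicit Defensive.
Import Order.TTheory GRing.Theory Num.Theory.
Import numFieldNormedType.Exports.
Local Open Scope classical_set_scope.
Local Open Scope ring_scope.

(* Data only; sign and ordering assumptions are hypotheses of the theorem. *)
Record bottleneck (R : realType) := Bottleneck {
  demand : R;     (* N *)
  capacity : R;   (* s *)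
  alpha : R;      (* unit cost of travel, waiting and charging time *)
  beta : R;       (* unit cost of early arrival *)
  gamma : R;      (* unit cost of late arrival *)
  dbar : R;       (* required charging time *)
  pbar : R        (* undiscounted charging price *)
}.

Definition rush_end (R : realType) (B : bottleneck R) : R :=
  demand B / capacity B.

Definition tstar (R : realType) (B : bottleneck R) : R :=
  gamma B * demand B / (capacity B * (beta B + gamma B)).

Definition entries (R : realType) (r : R -> R) (u t : R) : R :=
  \int[@lebesgue_measure R]_(x in `[u, t]) r x.

Definition departure_rate (R : realType) (B : bottleneck R) (r : R -> R) :
    Prop :=
  [/\ (forall t, t \in `[0, rush_end B] -> 0 <= r t),
      (@lebesgue_measure R).-integrable `[0, rush_end B] (EFin \o r)
    & entries r 0 (rush_end B) = demand B].

(* The third clause is the formula for [Q t], [that] being the last instant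
   before [t] at which the queue is empty; it is only meaningful when
   [0 < Q t].  By itself it would also accept [Q = 0] for an inflow exceeding
   the capacity; the last clause (at most [s * (t - u)] vehicles are served
   during [u, t]) rules this out, and the clauses together determine [Q] on
   [0, N / s]. *)
Definition queue_of (R : realType) (B : bottleneck R) (r Q : R -> R) : Prop :=
  let s := capacity B in
  [/\ Q 0 = 0,
      (forall t, t \in `[0, rush_end B] -> 0 <= Q t),
      (forall t, t \in `[0, rush_end B] -> 0 < Q t ->
        exists that, [/\ 0 <= that < t, Q that = 0,
          (forall u, that < u <= t -> 0 < Q u)
          & Q t = entries r that t - s * (t - that)])
    & (forall u t, 0 <= u -> u <= t -> t <= rush_end B ->
        entries r u t - s * (t - u) <= Q t)].

Definition wait (R : realType) (B : bottleneck R) (Q : R -> R) (t : R) : R :=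
  Q t / capacity B.

Definition earliness (R : realType) (B : bottleneck R) (Q : R -> R) (t : R) :
    R :=
  tstar B - t - wait B Q t.

Definition travel_cost (R : realType) (B : bottleneck R) (Q : R -> R) (t : R) :
    R :=
  alpha B * wait B Q t
  + Num.max (beta B * earliness B Q t) (- gamma B * earliness B Q t).

Definition perceived_discount (R : realType) (B : bottleneck R) (p : R -> R)
    (d t tau : R) : R :=
  - (p t / dbar B) * tau + p t / dbar B * (t - d + dbar B).

Definition charging_cost_of (R : realType) (B : bottleneck R) (p : R -> R)
    (t d : R) : R :=
  alpha B * d + (dbar B - d) * pbar B
  + \int[@lebesgue_measure R]_(tau in `[t - d, t])
      (pbar B - perceived_discount B p d t tau).

Definition charging_time (R : realType) (B : bottleneck R) (p : R -> R)
    (t : R) : R :=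
  if p t == 0 then 0 else Num.max ((1 - alpha B / p t) * dbar B) 0.

Definition charging_cost (R : realType) (B : bottleneck R) (p : R -> R)
    (t : R) : R :=
  charging_cost_of B p t (charging_time B p t).

Definition total_cost (R : realType) (B : bottleneck R) (p Q : R -> R)
    (t : R) : R :=
  travel_cost B Q t + charging_cost B p t.

Definition discount (R : realType) (B : bottleneck R) (p : R -> R) : Prop :=
  forall t, t \in `[0, rush_end B] -> 0 <= p t.

Definition equilibrium (R : realType) (B : bottleneck R) (p r Q : R -> R) :
    Prop :=
  [/\ departure_rate B r, queue_of B r Q
    & exists Ce, forall t, t \in `[0, rush_end B] -> total_cost B p Q t = Ce].

Definition total_travel_time (R : realType) (B : bottleneck R) (Q : R -> R) :
    R :=
  \int[@lebesgue_measure R]_(t in `[0, rush_end B]) wait B Q t.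

Definition monetary_budget (R : realType) (B : bottleneck R) (p r : R -> R) :
    R :=
  \int[@lebesgue_measure R]_(t in `[0, rush_end B])
    (r t * charging_time B p t * p t).

Definition feasible (R : realType) (B : bottleneck R) (M : R)
    (p r Q : R -> R) : Prop :=
  [/\ discount B p, equilibrium B p r Q & monetary_budget B p r <= M].

Definition optimal (R : realType) (B : bottleneck R) (M : R)
    (p r Q : R -> R) : Prop :=
  feasible B M p r Q /\
  forall p1 r1 Q1 : R -> R, feasible B M p1 r1 Q1 ->
    total_travel_time B Q <= total_travel_time B Q1.

(* Entering at [t] leads to arrival exactly at the desired arrival time, in the
   equilibrium under [p]. *)
Definition on_time_entry (R : realType) (B : bottleneck R) (p : R -> R)
    (t : R) : Prop :=
  t \in `[0, rush_end B] /\
  exists r Q, equilibrium B p r Q /\ t + wait B Q t = tstar B.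

(* The discount function [alpha - x + sqrt ((x - alpha)^2 - alpha^2)] at
   [x = h / dbar] is the root [p >= alpha] of
   [dbar * (p - alpha)^2 / (2 * p) = - h], for [h <= 0]. *)
Definition discount_of (R : realType) (B : bottleneck R) (h : R) : R :=
  alpha B - h / dbar B
  + Num.sqrt ((h / dbar B - alpha B) ^+ 2 - alpha B ^+ 2).

Definition full_discount (R : realType) (B : bottleneck R) (t : R) : R :=
  discount_of B (if t < tstar B then beta B * (t - tstar B)
                 else gamma B * (tstar B - t)).

Definition full_perceived (R : realType) (B : bottleneck R) : R :=
  beta B * gamma B * demand B ^+ 2 / (2 * capacity B * (beta B + gamma B)).

(* For [p >= alpha] the monetary outlay per commuter is
   [dbar * (p - alpha)] and the perceived one [dbar * (p - alpha)^2 / (2 * p)];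
   their difference is [dbar * (p^2 - alpha^2) / (2 * p)].  The factor [dbar] in
   the second summands of [full_budget] and [budget_of_perceived] comes from
   there; without it they would be dimensionally inconsistent and would equal
   the money spent only when [dbar = 1]. *)
Definition full_budget (R : realType) (B : bottleneck R) : R :=
  full_perceived B
  + capacity B * dbar B *
    \int[@lebesgue_measure R]_(t in `[0, rush_end B])
      ((full_discount B t ^+ 2 - alpha B ^+ 2) / (2 * full_discount B t)).

Definition left_time (R : realType) (B : bottleneck R) (m : R) : R :=
  Num.sqrt (2 * gamma B * m / (capacity B * beta B * (beta B + gamma B))).

Definition right_time (R : realType) (B : bottleneck R) (m : R) : R :=
  rush_end B
  - Num.sqrt (2 * beta B * m / (capacity B * gamma B * (beta B + gamma B))).

(* The map [f]. *)
Definition budget_of_perceived (R : realType) (B : bottleneck R) (m : R) : R :=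
  m + capacity B * dbar B / 2 *
    (dbar B / beta B *
       (\int[@lebesgue_measure R]_(y in
           `[alpha B, alpha B + beta B / dbar B * left_time B m])
          (2 * Num.sqrt (y ^+ 2 - alpha B ^+ 2)))
     + dbar B / gamma B *
       (\int[@lebesgue_measure R]_(z in
           `[alpha B, alpha B + gamma B / dbar B
                                * (rush_end B - right_time B m)])
          (2 * Num.sqrt (z ^+ 2 - alpha B ^+ 2)))).

(* The map [f^-1]. *)
Definition perceived_of_budget (R : realType) (B : bottleneck R) : R -> R :=
  'pinv_(fun=> 0) `[0, full_perceived B] (budget_of_perceived B).

(* Main.v *)
(* Let [c t] be the perceived gain from charging of a commuter entering at [t],
   [w] the waiting time and [phi] the schedule cost as a function of the arrival
   time.  At equilibrium [alpha * w t + phi (t + w t) = phi 0 - c 0 + c t]; the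
   left-hand side increases strictly with the wait, so [c] determines [w].
   Since [c t] and [w t] are nonnegative, that side is at least
   [max (phi 0 - c 0) (phi t)],
   hence [w] is bounded below by a function of [t] which decreases as [c 0]
   grows, with equality when [c t = max 0 (c 0 - phi 0 + phi t)].  The optimal
   discount is therefore of this form, with [K = c 0] as large as possible.

   The budget bounds [c 0]: a commuter arriving at [a] gains at least
   [max 0 (K - phi 0 + phi a)], which on [0, N / s] is at most its value [K] at
   the ends of the interval and is at least [K] afterwards, and the bottleneck
   serves at most [s] commuters per unit of time.  So the least expensive arrival
   pattern fills [0, N / s], and the budget is at least [s] times the integral
   of the corresponding outlay, which increases strictly with [K] and is attained
   by the discount of the theorem: it pays only commuters who do not queue. *)
Require Import Defs.
From HB Require Import structures.
From mathcomp Require Import all_boot all_order all_algebra.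
From mathcomp Require Import all_classical all_reals all_analysis.
From mathcomp Require Import measurable_realfun.
From mathcomp Require Import ring lra.

Set Implicit Arguments.
Unset Strict Implicit.
Unset Printing Implicit Defensive.
Import Order.TTheory GRing.Theory Num.Theory.
Import numFieldNormedType.Exports.
Local Open Scope classical_set_scope.
Local Open Scope ring_scope.

(** * Integration on segments *)

Section continuity_on_segments.
Variable R : realType.
Implicit Types (f g : R -> R) (a b : R).

(** Explicit moduli let continuity pass from one function to another whose increments it
    controls. *)
Lemma within_continuousP f (A : set R) : {within A, continuous f} <->
  forall x, A x -> forall e, 0 < e ->
    exists2 d, 0 < d & forall y, A y -> `|x - y| < d -> `|f x - f y| <= e.
Proof.
rewrite subspace_continuousP; split=> cf x Ax.
  move=> e e0; have /cvgrPdist_le/(_ e e0) := cf x Ax.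
  rewrite near_withinE => -[d /= d0 dP]; exists d => // y Ay xy.
  exact: dP.
apply/cvgrPdist_le => e e0; have [d d0 dP] := cf x Ax e e0.
by rewrite near_withinE; exists d => //= y xy Ay; exact: dP.
Qed.

Lemma within_continuous_comp f g (A : set R) :
  {within A, continuous f} -> continuous g -> {within A, continuous (g \o f)}.
Proof.
move=> /subspace_continuousP cf cg; apply/subspace_continuousP => x Ax.
exact: cvg_comp (cf x Ax) (cg (f x)).
Qed.

(* The supremum of the points reachable from [a] is reachable and, by the local
   hypothesis at this point, equal to [b]. *)
Lemma additive_segment_ind (P : R -> R -> Prop) a b : a <= b ->
  (forall u v w, a <= u -> u <= v -> v <= w -> w <= b ->
    P u v -> P v w -> P u w) ->
  (forall x, a <= x <= b -> exists2 d, 0 < d & forall u v,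
    a <= u -> u <= x -> x <= v -> v <= b -> v - u < d -> P u v) ->
  P a b.
Proof.
move=> ab Pcat Ploc.
pose S := [set x | a <= x <= b /\ P a x].
have Sa : S a.
  split; first by rewrite lexx.
  have [|d d0] := Ploc a; first by rewrite lexx.
  by apply; rewrite ?subrr.
have ubS : ubound S b by move=> x [/andP[]].
have hS : has_sup S by split; [exists a|exists b].
set c := sup S.
have ac : a <= c by apply: ub_le_sup => //; exists b.
have cb : c <= b by apply: ge_sup => //; exists a.
have [|d d0 dP] := Ploc c; first by rewrite ac.
have [u [/andP[au ub] Pu] cu] := sup_adherent (divr_gt0 d0 (ltr0n R 2)) hS.
rewrite -/c in cu.
have uc : u <= c.
  by apply: ub_le_sup; [exists b|split => //; rewrite au].
have Pc : P a c by apply: (Pcat a u c) => //; apply: dP => //; lra.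
suff : ~~ (c < b).
  by rewrite -leNgt => bc; rewrite -(@le_anti _ _ c b)// cb.
apply/negP => cltb; set v := Num.min b (c + d / 2).
have cv : c < v by rewrite lt_min cltb/=; lra.
have vb : v <= b by rewrite ge_min lexx.
have vd : v <= c + d / 2 by rewrite ge_min lexx orbT.
have : S v.
  split; first by rewrite vb (le_trans ac (ltW cv)).
  by apply: (Pcat a c v) => //; [exact: ltW|apply: dP => //; [exact: ltW|lra]].
move=> /(ub_le_sup (ex_intro _ b ubS)); rewrite -/c; lra.
Qed.

End continuity_on_segments.

(** * Comparison and transport of integrals *)

Section integrals_on_segments.
Variable R : realType.
Notation mu := (@lebesgue_measure R).
Implicit Types (f g : R -> R) (a b u v w : R).

Lemma integrable_sub_itv f a b u v : a <= u -> v <= b ->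
  mu.-integrable `[a, b] (EFin \o f) -> mu.-integrable `[u, v] (EFin \o f).
Proof.
move=> au vb; apply: integrableS => //.
by apply: subset_itvScc; rewrite bnd_simp.
Qed.

Lemma within_continuous_integrable f a b :
  {within `[a, b], continuous f} -> mu.-integrable `[a, b] (EFin \o f).
Proof.
move=> cf; apply: continuous_compact_integrable => //.
exact: segment_compact.
Qed.

Lemma continuous_integrable f a b :
  continuous f -> mu.-integrable `[a, b] (EFin \o f).
Proof.
by move=> cf; apply: within_continuous_integrable; exact: continuous_subspaceT.
Qed.

Lemma integrableM_within_continuous f g a b :
  mu.-integrable `[a, b] (EFin \o f) -> {within `[a, b], continuous g} ->
  mu.-integrable `[a, b] (EFin \o (f \* g)).
Proof.
move=> intf cg.
rewrite [X in integrable _ _ X](_ : _ = (EFin \o f) \* (EFin \o g))%E//.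
apply: integrableMl => //.
- by apply: subspace_continuous_measurable_fun => //; exact: measurable_itv.
- have /compact_bounded[M [_ mrt]] :=
    continuous_compact cg (@segment_compact _ a b).
  exists M; split; rewrite ?num_real// => x /mrt xM y yab.
  by apply: xM; exists y.
Qed.

Lemma Rintegral_cat f u v w : u <= v -> v <= w ->
  mu.-integrable `[u, w] (EFin \o f) ->
  \int[mu]_(x in `[u, w]) f x =
  \int[mu]_(x in `[u, v]) f x + \int[mu]_(x in `[v, w]) f x.
Proof.
move=> uv vw intf; apply/eqP; rewrite addrC -subr_eq; apply/eqP.
rewrite Rintegral_itvB ?bnd_simp//.
apply: Rintegral_itv_obnd_cbnd.
by apply: integrableS intf => //; apply: subset_itvScc; rewrite bnd_simp.
Qed.

Lemma Rintegral_itv_cst (c : R) u v : u <= v ->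
  \int[mu]_(x in `[u, v]) c = c * (v - u).
Proof.
by move=> uv; rewrite Rintegral_cst//= lebesgue_measure_itv/= lte_fin;
  case: ltgtP uv => // -> _; rewrite subrr.
Qed.

Lemma Rintegral_ge_cst f c u v : u <= v -> mu.-integrable `[u, v] (EFin \o f) ->
  (forall x, u <= x <= v -> c <= f x) ->
  c * (v - u) <= \int[mu]_(x in `[u, v]) f x.
Proof.
move=> uv intf fc; rewrite -Rintegral_itv_cst//; apply: le_Rintegral => //.
by apply: continuous_integrable => x; exact: cst_continuous.
Qed.

Lemma eq_Rintegral_itv f g u v : (forall x, u <= x <= v -> f x = g x) ->
  \int[mu]_(x in `[u, v]) f x = \int[mu]_(x in `[u, v]) g x.
Proof.
by move=> fg; apply: eq_Rintegral => x; rewrite inE/= in_itv/=; exact: fg.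
Qed.

Lemma le_Rintegral_itv f g u v :
  mu.-integrable `[u, v] (EFin \o f) -> mu.-integrable `[u, v] (EFin \o g) ->
  (forall x, u <= x <= v -> f x <= g x) ->
  \int[mu]_(x in `[u, v]) f x <= \int[mu]_(x in `[u, v]) g x.
Proof.
by move=> intf intg fg; exact: le_Rintegral.
Qed.

(** A strict inequality at one point would persist, with half the gap, on a window of positive
    length inside [[a, b]] and make the integral of [g] strictly larger. *)
Lemma le_Rintegral_continuous_eq f g a b : a < b ->
  {within `[a, b], continuous f} -> {within `[a, b], continuous g} ->
  (forall x, a <= x <= b -> f x <= g x) ->
  \int[mu]_(x in `[a, b]) g x <= \int[mu]_(x in `[a, b]) f x ->
  forall x, a <= x <= b -> f x = g x.
Proof.
move=> ab cf cg fg gf x /[dup] xab /andP[ax xb].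
have intf := within_continuous_integrable cf.
have intg := within_continuous_integrable cg.
pose h y := g y - f y.
have h0 y : a <= y <= b -> 0 <= h y by move=> /fg; rewrite subr_ge0.
have ch : {within `[a, b], continuous h}.
  by move=> y; apply: continuousB; [exact: cg|exact: cf].
have inth := within_continuous_integrable ch.
apply/eqP; rewrite eq_le fg//= leNgt; apply/negP => fgx.
have hx : 0 < h x by rewrite subr_gt0.
have /within_continuousP/(_ x) := ch.
rewrite /= in_itv/= => /(_ xab (h x / 2))[|d d0 dP]; first by rewrite divr_gt0.
(* Clipping keeps the window inside [[a, b]]; since [a < b], it stays nondegenerate even when [x] is
   an endpoint. *)
pose u := Num.max a (x - d / 2); pose v := Num.min b (x + d / 2).
have au : a <= u by rewrite le_max lexx.
have ux : u <= x by rewrite ge_max ax/=; lra.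
have xv : x <= v by rewrite le_min xb/=; lra.
have vb : v <= b by rewrite ge_min lexx.
have du : x - d / 2 <= u by rewrite le_max lexx orbT.
have dv : v <= x + d / 2 by rewrite ge_min lexx orbT.
have uv : u < v.
  rewrite /u /v gt_max !lt_min ab/=; apply/andP; split; first by lra.
  by apply/andP; split; lra.
have : h x / 2 * (v - u) <= \int[mu]_(y in `[u, v]) h y.
  apply: Rintegral_ge_cst; [exact: ltW|exact: integrable_sub_itv inth|].
  move=> y /andP[uy yv].
  have := dP y.
  rewrite /= in_itv/= (le_trans au uy) (le_trans yv vb) => /(_ isT).
  rewrite ltr_norml => /(_ ltac:(by apply/andP; split; lra)).
  by rewrite ler_norml => /andP[]; lra.
apply/negP; rewrite -ltNge; apply: (@le_lt_trans _ _ 0); last first.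
  by rewrite mulr_gt0 ?divr_gt0 ?subr_gt0.
have hab : \int[mu]_(y in `[a, b]) h y <= 0.
  by rewrite RintegralB// subr_le0.
apply: le_trans hab.
rewrite (@Rintegral_cat _ a u b)//; last exact: le_trans xb.
rewrite (@Rintegral_cat _ u v b)//; last 2 first.
- exact: ltW.
- exact: integrable_sub_itv inth.
have ge0 c e : a <= c -> e <= b -> 0 <= \int[mu]_(y in `[c, e]) h y.
  move=> ac eb; apply: Rintegral_ge0 => y; rewrite /= in_itv/= => /andP[cy ye].
  by apply: h0; rewrite (le_trans ac cy) (le_trans ye eb).
have au0 := ge0 a u (lexx a) (le_trans (ltW uv) vb).
have vb0 := ge0 v b (le_trans au (ltW uv)) (lexx b).
by rewrite addrCA lerDl addr_ge0.
Qed.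

(* On small windows [D \o a] is almost constant, so the hypothesis on [r] gives
   the inequality up to an error proportional to the increment of [a]. *)
Lemma Rintegral_comp_le (r a D : R -> R) (x0 x1 : R) : x0 <= x1 ->
  (forall x, x0 <= x <= x1 -> 0 <= r x) ->
  mu.-integrable `[x0, x1] (EFin \o r) ->
  {within `[x0, x1], continuous a} ->
  continuous D -> (forall y, 0 <= D y) ->
  (forall u v, x0 <= u -> u <= v -> v <= x1 ->
    \int[mu]_(x in `[u, v]) r x <= a v - a u) ->
  \int[mu]_(x in `[x0, x1]) (r x * D (a x)) <=
  \int[mu]_(y in `[a x0, a x1]) D y.
Proof.
move=> x01 r0 intr ca cD D0 ra.
have mono u v : x0 <= u -> u <= v -> v <= x1 -> a u <= a v.
  move=> xu uv vx; rewrite -subr_ge0 (le_trans _ (ra _ _ xu uv vx))//.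
  apply: Rintegral_ge0 => x; rewrite /= in_itv/= => /andP[ux xv].
  by apply: r0; rewrite (le_trans xu ux) (le_trans xv vx).
have intrD : mu.-integrable `[x0, x1] (EFin \o (r \* (D \o a))).
  by apply: integrableM_within_continuous => //; exact: within_continuous_comp.
apply/ler_addgt0Pr => e e0.
(* The total error is [e'] times the increment of [a]; adding 1 to the increment avoids a division
   by zero. *)
have [e' e'0 e'a] : exists2 e', 0 < e' & e' * (a x1 - a x0) <= e.
  exists (e / (a x1 - a x0 + 1)).
    by rewrite divr_gt0// ltr_wpDl// subr_ge0 mono.
  rewrite mulrAC ler_pdivrMr; last by rewrite ltr_wpDl// subr_ge0 mono.
  by rewrite ler_pM2l// lerDl.
apply: (@le_trans _ _
  (\int[mu]_(y in `[a x0, a x1]) D y + e' * (a x1 - a x0))); last first.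
  by rewrite lerD2l.
pose P u v := \int[mu]_(x in `[u, v]) (r x * D (a x)) <=
  \int[mu]_(y in `[a u, a v]) D y + e' * (a v - a u).
change (P x0 x1); apply: (@additive_segment_ind _ P) => //.
  move=> u v w xu uv vw wx; rewrite /P => uvP vwP.
  rewrite (@Rintegral_cat _ u v w)//; last exact: integrable_sub_itv intrD.
  rewrite (@Rintegral_cat D (a u) (a v) (a w))//; last 3 first.
  - by apply: mono => //; exact: le_trans vw wx.
  - by apply: mono => //; exact: le_trans xu uv.
  - exact: continuous_integrable.
  lra.
move=> x /[dup] xx01 /andP[x0x xx1].
have /cvgrPdist_le/(_ (e' / 2)) := cD (a x).
case=> [|eta /= eta0 etaP]; first by rewrite divr_gt0.
(* On the window [a] moves by at most [eta / 2], hence stays strictly within [eta] of [a x], where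
   [D] varies by at most [e' / 2]. Both integrals are then compared with [D (a x)] times
   [a v - a u]. *)
have /within_continuousP/(_ x) := ca.
rewrite /= in_itv/= => /(_ xx01 (eta / 2))[|d d0 dP]; first by rewrite divr_gt0.
exists d => // u v xu ux xv vx uvd; rewrite /P.
have auav : a u <= a v by apply: mono => //; exact: le_trans xv.
have near_x y : u <= y <= v -> `|a x - a y| <= eta / 2.
  move=> /andP[uy yv]; apply: dP.
    by rewrite /= in_itv/= (le_trans xu uy) (le_trans yv vx).
  by rewrite ltr_norml; apply/andP; split; lra.
have Dnear y : u <= y <= v -> `|D (a x) - D (a y)| <= e' / 2.
  by move=> /near_x yx; apply: etaP; rewrite /= (le_lt_trans yx)//; lra.
have uvT : u <= v := le_trans ux xv.
have Dnear' y : a u <= y <= a v -> `|D (a x) - D y| <= e' / 2.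
  move=> /andP[auy yav]; apply: etaP => /=.
  have := near_x u; have := near_x v; rewrite !lexx uvT => /(_ isT) + /(_ isT).
  rewrite !ler_norml ltr_norml => /andP[? ?] /andP[? ?].
  by apply/andP; split; lra.
have intruv := integrable_sub_itv xu vx intr.
have c0 : 0 <= D (a x) + e' / 2 by rewrite addr_ge0// divr_ge0// ltW.
have H1 : \int[mu]_(y in `[u, v]) (r y * D (a y)) <=
    (D (a x) + e' / 2) * (a v - a u).
  apply: (@le_trans _ _ ((D (a x) + e' / 2) * \int[mu]_(y in `[u, v]) r y)).
    rewrite -RintegralZl//; apply: le_Rintegral_itv.
    - exact: integrable_sub_itv intrD.
    - by apply: (integrableZl _ (D (a x) + e' / 2) intruv).
    - move=> y /[dup] /andP[uy yv] /Dnear; rewrite ler_norml => /andP[? ?].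
      rewrite mulrC; apply: ler_wpM2r; last by lra.
      by apply: r0; rewrite (le_trans xu uy) (le_trans yv vx).
  by rewrite ler_wpM2l// ra.
have H2 : (D (a x) - e' / 2) * (a v - a u) <= \int[mu]_(y in `[a u, a v]) D y.
  apply: Rintegral_ge_cst => //; first exact: continuous_integrable.
  by move=> y /Dnear'; rewrite ler_norml => /andP[? ?]; lra.
apply: (le_trans H1); rewrite -lerBlDr; apply: le_trans H2; lra.
Qed.

End integrals_on_segments.

(** * Affine changes of variable *)

Section affine_substitution.
Variable R : realType.
Notation mu := (@lebesgue_measure R).
Implicit Types (G : R -> R) (a b c k : R).

Lemma continuous_affine k c : continuous (fun x : R => k * x + c).
Proof.
move=> x; apply: cvgD; last exact: cvg_cst.
by apply: cvgM; [exact: cvg_cst|exact: cvg_id].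
Qed.

Lemma Rintegral_affine_incr G k c a b : 0 < k -> a <= b -> continuous G ->
  \int[mu]_(y in `[k * a + c, k * b + c]) G y =
  k * \int[mu]_(x in `[a, b]) G (k * x + c).
Proof.
move=> k0 ab cG.
pose F x : R := k * x + c.
have Fd (x : R) : is_derive x 1 F k.
  rewrite /F; apply: is_derive_eq; rewrite /GRing.scale/=. by ring.
have F'E : derive1 F = cst k.
  by apply/funext => x; rewrite derive1E; apply: derive_val.
have cF : continuous F by exact: continuous_affine.
rewrite -RintegralZl//; last first.
  apply: continuous_integrable => x.
  by apply: continuous_comp; [exact: cF|exact: cG].
rewrite /Rintegral -/(F a) -/(F b).
rewrite (@integration_by_substitution_increasing _ F)//.
- by congr fine; apply: eq_integral => x _; rewrite F'E /= mulrC.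
- by move=> x y _ _ xy; rewrite /F ltrD2r ltr_pM2l.
- by rewrite F'E => ? _; exact: cvg_cst.
- by rewrite F'E; exact: is_cvg_cst.
- by rewrite F'E; exact: is_cvg_cst.
- split => [x _||]; first exact: ex_derive.
  + by apply: cvg_at_right_filter; exact: cF.
  + by apply: cvg_at_left_filter; exact: cF.
- exact: continuous_subspaceT.
Qed.

(** Reflecting the variable reduces this to the increasing case. *)
Lemma Rintegral_affine_decr G k c a b : 0 < k -> a <= b -> continuous G ->
  \int[mu]_(y in `[c - k * b, c - k * a]) G y =
  k * \int[mu]_(x in `[a, b]) G (c - k * x).
Proof.
move=> k0 ab cG.
have -> : \int[mu]_(x in `[a, b]) G (c - k * x) =
    \int[mu]_(x in `[(- b)%R, (- a)%R]) G (k * x + c).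
  rewrite [RHS]/Rintegral integration_by_substitution_oppr//.
    by congr fine; apply: eq_integral => x _ /=; rewrite mulrN addrC.
  apply: continuous_subspaceT => x.
  by apply: continuous_comp; [exact: continuous_affine|exact: cG].
rewrite -Rintegral_affine_incr ?lerN2//.
by rewrite !mulrN ![_ + c]addrC.
Qed.

Lemma Rintegral_affine k c a b : a <= b ->
  \int[mu]_(x in `[a, b]) (k * x + c) = (k * (b + a) / 2 + c) * (b - a).
Proof.
rewrite le_eqVlt => /predU1P[->|ab].
  by rewrite set_itv1 Rintegral_set1 subrr mulr0.
pose F x : R := k / 2 * x ^+ 2 + c * x.
have Fd (x : R) : is_derive x 1 F (k * x + c).
  rewrite /F; apply: is_derive_eq; rewrite /GRing.scale/=; by field.
rewrite /Rintegral (@continuous_FTC2 _ _ F)//.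
- by rewrite -EFinB/= /F; field.
- exact/continuous_subspaceT/continuous_affine.
- have cF : continuous F.
    move=> x; apply: differentiable_continuous; apply/derivable1_diffP.
    exact: ex_derive.
  split => [x _||]; first exact: ex_derive.
  + by apply: cvg_at_right_filter; exact: cF.
  + by apply: cvg_at_left_filter; exact: cF.
- by move=> x _; rewrite derive1E; apply: derive_val.
Qed.

End affine_substitution.

(** * Primitives: almost everywhere uniqueness and gluing *)

Section primitives.
Variable R : realType.
Notation mu := (@lebesgue_measure R).

(** Extended by zero outside [[a, b]], the difference [f - g] has a vanishing primitive, and
    Lebesgue differentiation recovers it almost everywhere. *)
Lemma Rintegral_eq_ae (f g : R -> R) (a b : R) :
  mu.-integrable `[a, b] (EFin \o f) -> mu.-integrable `[a, b] (EFin \o g) ->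
  (forall x, a <= x <= b ->
    \int[mu]_(y in `[a, x]) f y = \int[mu]_(y in `[a, x]) g y) ->
  {ae mu, forall x, x \in `[a, b] -> f x = g x}.
Proof.
move=> intf intg fg.
pose h x := f x - g x.
have inth : mu.-integrable `[a, b] (EFin \o h).
  by apply: (integrableB _ intf intg).
have inthr (y : itv_bound R) :
    mu.-integrable [set` Interval -oo%O y] (EFin \o (h \_ `[a, b])).
  rewrite -restrict_EFin; apply/integrable_restrict => //.
  by apply: integrableS inth => //; exact: measurableI.
have loch : locally_integrable [set: R] (h \_ `[a, b]).
  exact: integrable_locally.
have := FTC1Ny (fun y => inthr (BRight y)) loch.
apply: filterS; first exact: (ae_filter_ringOfSetsType mu).
move=> x /= [_].
set F := fun _ => _.
(* [F y] integrates from minus infinity to [y]: this domain meets [[a, b]] in nothing, in [[a, y]]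
   or in the whole segment, according to the position of [y]. *)
have -> : F = cst 0.
  apply/funext => y; rewrite /F /= -Rintegral_mkcondr.
  have [ya|ay] := ltP y a.
    rewrite (_ : _ `&` _ = set0) ?Rintegral_set0//.
    rewrite -subset0 => z [] /=; rewrite !in_itv/= => zy /andP[az _].
    by move: (lt_le_trans ya (le_trans az zy)); rewrite ltxx.
  have [yb|by_] := leP y b.
    rewrite (_ : _ `&` _ = `[a, y]%classic).
      rewrite RintegralB//; [|exact: integrable_sub_itv intf
                             |exact: integrable_sub_itv intg].
      by rewrite fg ?subrr// ay yb.
    apply/seteqP; split => z /=; rewrite !in_itv/=.
      by move=> [zy /andP[-> _]].
    by move=> /andP[az zy]; rewrite zy az (le_trans zy yb).
  rewrite (_ : _ `&` _ = `[a, b]%classic).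
    rewrite RintegralB//; have [ab|ba] := leP a b.
      by rewrite fg ?subrr// ab lexx.
    by rewrite set_itv_ge ?bnd_simp -?ltNge// !Rintegral_set0 subrr.
  apply/setIidPr => z /=; rewrite !in_itv/= => /andP[_ zb].
  exact: le_trans zb (ltW by_).
rewrite derive1_cst => /esym + xab.
by rewrite patchE mem_set//= => /eqP; rewrite subr_eq0 => /eqP.
Qed.

Lemma bounded_integrable_itv (f : R -> R) (a b M : R) :
  (forall x, `|f x| <= M) -> measurable_fun `[a, b] f ->
  mu.-integrable `[a, b] (EFin \o f).
Proof.
move=> fM mf; apply: measurable_bounded_integrable => //.
  by apply: compact_finite_measure; exact: segment_compact.
exists M; split; rewrite ?num_real// => x Mx y _.
exact: le_trans (fM y) (ltW Mx).
Qed.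

(** Measurability is carried along because gluing two pieces requires integrability on their union;
    quantifying over all subsegments allows a cut at any breakpoint. *)
Definition primitive_on (f F : R -> R) (a b : R) := forall u v,
  a <= u -> u <= v -> v <= b -> measurable_fun `[u, v] f /\
  \int[mu]_(x in `[u, v]) f x = F v - F u.

(** Endpoints are negligible, so [f] is prescribed only inside; the conventions at the breakpoints
    of a piecewise constant rate are then harmless. *)
Lemma primitive_on_cst (f F : R -> R) (a b c e : R) :
  (forall x, a < x < b -> f x = c) ->
  (forall x, a <= x <= b -> F x = c * x + e) -> primitive_on f F a b.
Proof.
move=> fc FE u v au uv vb.
have mf : measurable_fun `]u, v[ f.
  apply: (@eq_measurable_fun _ _ _ _ _ (cst c)) => //.
  move=> x; rewrite inE/= in_itv/= => /andP[ux xv].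
  by rewrite fc// (le_lt_trans au ux) (lt_le_trans xv vb).
split; first exact: measurable_fun_itv_cc mf.
rewrite !FE ?(le_trans au uv) ?au ?(le_trans uv vb) ?vb//.
rewrite [LHS](_ : _ = \int[mu]_(x in `[u, v]) c).
  by rewrite Rintegral_itv_cst//; ring.
rewrite /Rintegral; congr fine.
rewrite [LHS]integral_itv_bndoo; last exact/measurable_EFinP.
rewrite [RHS]integral_itv_bndoo; last by apply/measurable_EFinP.
apply: eq_integral => x; rewrite inE/= in_itv/= => /andP[ux xv].
by rewrite fc// (le_lt_trans au ux) (lt_le_trans xv vb).
Qed.

Lemma primitive_on_cat (f F : R -> R) (a b c M : R) :
  (forall x, `|f x| <= M) -> a <= b -> b <= c ->
  primitive_on f F a b -> primitive_on f F b c -> primitive_on f F a c.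
Proof.
move=> fM ab bc Fab Fbc u w au uw wc.
have [ub|/ltW bu] := leP w b; first exact: Fab.
have [ub|/ltW bu'] := leP u b; last exact: Fbc.
have [m1 i1] := Fab u b au ub (lexx b).
have [m2 i2] := Fbc b w (lexx b) bu wc.
have m : measurable_fun `[u, w] f.
  rewrite (_ : `[u, w]%classic = `[u, b]%classic `|` `[b, w]%classic).
    by apply/(measurable_funU f (measurable_itv _) (measurable_itv _)); split.
  apply/seteqP; split => x /=; rewrite !in_itv/=.
    by move=> /andP[-> ->]; have [xb|/ltW bx] := leP x b; [left|right];
      rewrite ?xb ?bx.
  by move=> [/andP[ux xb]|/andP[bx xw]]; apply/andP; split => //;
    [exact: le_trans bu|exact: le_trans bx].
split => //; rewrite (Rintegral_cat ub bu) ?i1 ?i2; first by ring.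
exact: bounded_integrable_itv fM m.
Qed.

End primitives.

(** * The bottleneck with charging *)

Section model.
Variables (R : realType) (B : bottleneck R).
Hypotheses (demand_gt0 : 0 < demand B) (capacity_gt0 : 0 < capacity B)
  (beta_gt0 : 0 < beta B) (beta_lt_alpha : beta B < alpha B)
  (alpha_lt_gamma : alpha B < gamma B) (dbar_gt0 : 0 < dbar B).

Local Notation mu := (@lebesgue_measure R).
Local Notation N := (demand B).
Local Notation s := (capacity B).
Local Notation al := (alpha B).
Local Notation be := (beta B).
Local Notation ga := (gamma B).
Local Notation db := (dbar B).
Local Notation T := (rush_end B).
Local Notation ts := (tstar B).

Implicit Types (p r Q : R -> R) (t u v w K c P : R).

(** * Optimal charging: time, outlay and perceived gain *)

Lemma alpha_gt0 : 0 < al. Proof. exact: lt_trans beta_lt_alpha. Qed.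
Lemma gamma_gt0 : 0 < ga. Proof. exact: lt_trans alpha_gt0 _. Qed.

(** For [P >= al], what optimal charging saves compared with [db * pbar B]. A discount below [al]
    induces no charging, so [Num.max (p t) al] serves as the effective discount below. *)
Definition perceived_gain P : R := db * (P - al) ^+ 2 / (2 * P).

Lemma charging_timeE p t : 0 <= p t ->
  charging_time B p t = (1 - al / Num.max (p t) al) * db.
Proof.
move=> p0; rewrite /charging_time; have a0 := alpha_gt0.
have [->|pn0] := eqVneq (p t) 0.
  by rewrite max_r ?(ltW a0)// divff ?lt0r_neq0// subrr mul0r.
have {pn0}p0 : 0 < p t by rewrite lt_def pn0.
have [pa|ap] := leP (p t) al.
  rewrite max_r; first by rewrite divff ?lt0r_neq0// subrr mul0r.
  by rewrite pmulr_lle0// subr_le0 ler_pdivlMr ?mul1r.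
by rewrite max_l// mulr_ge0 ?ltW// subr_gt0 ltr_pdivrMr ?mul1r.
Qed.

Lemma outlayE p t : 0 <= p t ->
  charging_time B p t * p t = db * (Num.max (p t) al - al).
Proof.
move=> p0; rewrite charging_timeE//; have a0 := alpha_gt0.
have [pa|ap] := leP (p t) al.
  by rewrite divff ?lt0r_neq0// !subrr !(mul0r, mulr0).
by field; rewrite lt0r_neq0// (lt_trans a0).
Qed.

Lemma charging_costE p t : 0 <= p t ->
  charging_cost B p t = db * pbar B - perceived_gain (Num.max (p t) al).
Proof.
move=> p0; have a0 := alpha_gt0.
have ct0 : 0 <= charging_time B p t.
  rewrite charging_timeE// (mulr_ge0 _ (ltW dbar_gt0))// subr_ge0.
  rewrite ler_pdivrMr ?mul1r.
    by rewrite le_max lexx orbT.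
  by rewrite lt_max a0 orbT.
rewrite /charging_cost /charging_cost_of; set d := charging_time B p t in ct0 *.
have -> : \int[mu]_(tau in `[t - d, t])
        (pbar B - perceived_discount B p d t tau) =
      \int[mu]_(tau in `[t - d, t])
        (p t / db * tau + (pbar B - p t / db * (t - d + db))).
  by apply: eq_Rintegral => x _; rewrite /perceived_discount; ring.
rewrite Rintegral_affine; last by rewrite gerBl.
have := outlayE p0; rewrite -/d /perceived_gain.
have [pa|ap] := leP (p t) al => dp.
  have dp0 : d * p t = 0 by rewrite dp subrr mulr0.
  have -> : d = 0.
    rewrite /d charging_timeE// max_r// divff ?lt0r_neq0//.
    by rewrite subrr mul0r.
  by rewrite subrr expr0n/=; ring.
have p1 : 0 < p t by rewrite (lt_trans a0).
have -> : d = (1 - al / p t) * db.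
  by rewrite /d charging_timeE// max_l// ltW.
by field; rewrite !lt0r_neq0.
Qed.

Lemma discount_ofE c : discount_of B (- c) =
  al + c / db + Num.sqrt ((c / db) ^+ 2 + 2 * al * (c / db)).
Proof. by rewrite /discount_of mulNr opprK; congr (_ + Num.sqrt _); ring. Qed.

(** At the gain of [P] the radicand is the square of [(P ^+ 2 - al ^+ 2) / (2 * P)]. With
    [perceived_gain_discount_of], this makes [discount_of] at [- c] the inverse of
    [perceived_gain]. *)
Lemma discount_of_gain P : al <= P -> discount_of B (- perceived_gain P) = P.
Proof.
move=> aP; have a0 := alpha_gt0; have P0 : 0 < P := lt_le_trans a0 aP.
rewrite discount_ofE /perceived_gain.
have -> : db * (P - al) ^+ 2 / (2 * P) / db = (P - al) ^+ 2 / (2 * P).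
  by field; rewrite !lt0r_neq0.
have -> : ((P - al) ^+ 2 / (2 * P)) ^+ 2 + 2 * al * ((P - al) ^+ 2 / (2 * P)) =
    ((P ^+ 2 - al ^+ 2) / (2 * P)) ^+ 2 by field; rewrite lt0r_neq0.
rewrite sqrtr_sqr ger0_norm; first by field; rewrite lt0r_neq0.
apply: divr_ge0; last by rewrite mulr_ge0// ltW.
by rewrite subr_ge0 ler_sqr// nnegrE ltW.
Qed.

Lemma discount_of_ge c : 0 <= c -> al <= discount_of B (- c).
Proof.
move=> c0; rewrite discount_ofE -addrA lerDl addr_ge0 ?sqrtr_ge0//.
by rewrite divr_ge0// ltW.
Qed.

Lemma perceived_gain_discount_of c : 0 <= c ->
  perceived_gain (discount_of B (- c)) = c.
Proof.
move=> c0; have a0 := alpha_gt0.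
have P0 : 0 < discount_of B (- c) := lt_le_trans a0 (discount_of_ge c0).
have x0 : 0 <= c / db by rewrite divr_ge0// ltW.
have cE : c = db * (c / db) by field; exact: lt0r_neq0.
rewrite [RHS]cE; move: P0 x0; rewrite /perceived_gain discount_ofE.
move: (c / db) => x P0 x0.
have : Num.sqrt (x ^+ 2 + 2 * al * x) ^+ 2 = x ^+ 2 + 2 * al * x.
  by rewrite sqr_sqrtr// addr_ge0 ?sqr_ge0// !mulr_ge0// ltW.
move: P0; set S := Num.sqrt _ => P0 S2.
(* The quadratic equation solved by the discount appears once the square of [S] is replaced by the
   radicand. *)
have -> : (al + x + S - al) ^+ 2 =
    2 * x * (al + x + S) + (S ^+ 2 - (x ^+ 2 + 2 * al * x)).
  by ring.
by rewrite S2 subrr addr0; field; rewrite lt0r_neq0.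
Qed.

Lemma ltr_discount_of c c' : 0 <= c -> c < c' ->
  discount_of B (- c) < discount_of B (- c').
Proof.
move=> c0 cc'; rewrite !discount_ofE.
have xy : c / db < c' / db by rewrite ltr_pM2r ?invr_gt0.
have x0 : 0 <= c / db by rewrite divr_ge0// ltW.
have y0 : 0 <= c' / db := le_trans x0 (ltW xy).
apply: ltr_leD; first by rewrite ltrD2l.
apply: ler_wsqrtr; apply: lerD; first by rewrite ler_sqr ?nnegrE// ltW.
by rewrite ler_pM2l ?(ltW xy)// mulr_gt0 ?alpha_gt0.
Qed.

Lemma ler_discount_of c c' : 0 <= c -> c <= c' ->
  discount_of B (- c) <= discount_of B (- c').
Proof.
by move=> c0; rewrite le_eqVlt => /predU1P[->//|/(ltr_discount_of c0)/ltW].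
Qed.

(** The money paid to one commuter who charges optimally under the discount whose perceived gain is
    [c]. *)
Definition outlay c : R := db * (discount_of B (- c) - al).

Lemma ler_outlay c c' : 0 <= c -> c <= c' -> outlay c <= outlay c'.
Proof. by move=> c0 cc'; rewrite ler_pM2l// lerD2r ler_discount_of. Qed.

Lemma ltr_outlay c c' : 0 <= c -> c < c' -> outlay c < outlay c'.
Proof. by move=> c0 cc'; rewrite ltr_pM2l// ltrD2r ltr_discount_of. Qed.

Lemma outlay0 : outlay 0 = 0.
Proof.
rewrite /outlay discount_ofE mul0r expr0n/= mulr0 !addr0 sqrtr0 addr0.
by rewrite subrr mulr0.
Qed.

Lemma continuous_outlay : continuous outlay.
Proof.
have cx c : (fun c : R => c / db) @ c --> c / db.
  by apply: cvgM; [exact: cvg_id|exact: cvg_cst].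
move=> c; rewrite /continuous_at /outlay !discount_ofE.
under eq_fun do rewrite discount_ofE.
apply: cvgM; first exact: cvg_cst.
apply: cvgB; last exact: cvg_cst.
apply: cvgD; first by apply: cvgD; [exact: cvg_cst|exact: cx].
apply: (@cvg_comp _ _ _ _ (@Num.sqrt R)); last exact: sqrt_continuous.
apply: cvgD; first by apply: cvgM; exact: cx.
by apply: cvgM; [exact: cvg_cst|exact: cx].
Qed.

Lemma outlayE_gain p t : 0 <= p t -> charging_time B p t * p t =
  outlay (perceived_gain (Num.max (p t) al)).
Proof.
by move=> p0; rewrite outlayE// /outlay discount_of_gain// le_max lexx orbT.
Qed.

Lemma perceived_gain_ge0 P : al <= P -> 0 <= perceived_gain P.
Proof.
move=> aP; have P0 : 0 < P := lt_le_trans alpha_gt0 aP.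
apply: divr_ge0; last by rewrite mulr_ge0// ltW.
by rewrite mulr_ge0 ?sqr_ge0// ltW.
Qed.

(** * Schedule cost and cost of an entry *)

Definition schedule_cost a : R :=
  Num.max (be * (ts - a)) (- ga * (ts - a)).

Definition entry_cost t w : R := al * w + schedule_cost (t + w).

(** The schedule cost at both ends of [[0, T]]; the time origin is chosen so that they agree, see
    [peak_late]. *)
Definition peak : R := be * ts.

Lemma schedule_costE a :
  schedule_cost a = if a <= ts then be * (ts - a) else ga * (a - ts).
Proof.
have g0 := gamma_gt0; rewrite /schedule_cost.
have bg : 0 < be + ga by rewrite addr_gt0.
have [ats|tsa] := leP a ts.
  by rewrite max_l// -subr_ge0 mulNr opprK -mulrDl mulr_ge0 ?subr_ge0// ltW.
rewrite max_r; first by rewrite mulNr -mulrN opprB.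
by rewrite -subr_le0 mulNr opprK -mulrDl pmulr_rle0// subr_le0 ltW.
Qed.

Lemma rush_end_gt0 : 0 < T. Proof. exact: divr_gt0. Qed.

Lemma tstar_gt0 : 0 < ts.
Proof. by rewrite divr_gt0 ?mulr_gt0 ?addr_gt0// gamma_gt0. Qed.

Lemma peak_gt0 : 0 < peak. Proof. by rewrite mulr_gt0// tstar_gt0. Qed.

Lemma peak_late : ga * (T - ts) = peak.
Proof.
rewrite /peak /tstar /rush_end; field.
by rewrite !lt0r_neq0// addr_gt0// gamma_gt0.
Qed.

Lemma tstar_lt_rush_end : ts < T.
Proof. by rewrite -subr_gt0 -(pmulr_rgt0 _ gamma_gt0) peak_late peak_gt0. Qed.

Lemma mass_rush : s * T = N.
Proof. by rewrite /rush_end mulrCA divff ?mulr1 ?lt0r_neq0. Qed.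

Lemma schedule_cost_ge0 a : 0 <= schedule_cost a.
Proof.
rewrite schedule_costE; have [ats|ats] := leP a ts.
  by rewrite mulr_ge0 ?subr_ge0// ltW.
by rewrite mulr_ge0 ?subr_ge0 ?ltW// gamma_gt0.
Qed.

Lemma schedule_cost0 : schedule_cost 0 = peak.
Proof. by rewrite schedule_costE (ltW tstar_gt0) subr0. Qed.

Lemma schedule_cost_tstar : schedule_cost ts = 0.
Proof. by rewrite schedule_costE lexx subrr mulr0. Qed.

Lemma schedule_cost_le_peak a : 0 <= a <= T -> schedule_cost a <= peak.
Proof.
move=> /andP[a0 aT]; rewrite schedule_costE; have [_|_] := leP a ts.
  by rewrite ler_pM2l// gerBl.
by rewrite -peak_late ler_pM2l ?gamma_gt0// lerD2r.
Qed.

Lemma schedule_cost_ge_peak a : T <= a -> peak <= schedule_cost a.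
Proof.
move=> Ta; rewrite schedule_costE [a <= ts]leNgt.
rewrite (lt_le_trans tstar_lt_rush_end Ta)/=.
by rewrite -peak_late ler_pM2l ?gamma_gt0// lerD2r.
Qed.

Lemma continuous_schedule_cost : continuous schedule_cost.
Proof.
have cl : continuous (fun a : R => ts - a).
  by move=> a; apply: cvgB; [exact: cvg_cst|exact: cvg_id].
by apply: max_fun_continuous => a; apply: cvgM => //; [exact: cvg_cst|exact: cl
  |exact: cvg_cst|exact: cl].
Qed.

Lemma travel_costE Q t : travel_cost B Q t = entry_cost t (wait B Q t).
Proof.
by rewrite /travel_cost /entry_cost /schedule_cost /earliness opprD addrA.
Qed.

Lemma entry_cost0 t : entry_cost t 0 = schedule_cost t.
Proof. by rewrite /entry_cost mulr0 add0r addr0. Qed.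

(* Since [beta < alpha], arriving later saves less than the additional waiting
   costs. *)
Lemma ltr_entry_cost t w w' : w < w' -> entry_cost t w < entry_cost t w'.
Proof.
move=> ww'; rewrite /entry_cost /schedule_cost.
have g0 := gamma_gt0.
have h1 : 0 < (al - be) * (w' - w) by rewrite mulr_gt0 ?subr_gt0.
have h2 : 0 < (al + ga) * (w' - w).
  by rewrite mulr_gt0 ?subr_gt0// addr_gt0// alpha_gt0.
rewrite -ltrBrDl gt_max; apply/andP; split; rewrite ltrBrDl.
  apply: (@lt_le_trans _ _ (al * w' + be * (ts - (t + w')))); first by lra.
  by rewrite lerD2l le_max lexx.
apply: (@lt_le_trans _ _ (al * w' + - ga * (ts - (t + w')))); first by lra.
by rewrite lerD2l le_max lexx orbT.
Qed.

Lemma entry_cost_inj t : injective (entry_cost t).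
Proof.
move=> w w' e; apply/eqP; rewrite eq_le !leNgt.
by apply/andP; split; apply/negP => /(ltr_entry_cost t); rewrite e ltxx.
Qed.

Lemma ler_entry_cost t w w' : entry_cost t w <= entry_cost t w' -> w <= w'.
Proof. by rewrite !leNgt; apply: contra; exact: ltr_entry_cost. Qed.

Lemma continuous_entry_cost (A : set R) f : {within A, continuous f} ->
  {within A, continuous (fun t => entry_cost t (f t))}.
Proof.
move=> /subspace_continuousP cf; apply/subspace_continuousP => t At.
apply: cvgD; first by apply: cvgM; [exact: cvg_cst|exact: cf].
apply: (@cvg_comp _ _ _ _ schedule_cost); last exact: continuous_schedule_cost.
by apply: cvgD; [exact: cvg_within|exact: cf].
Qed.

(* The least gain, as a function of the arrival time, compatible with an
   equilibrium in which the first commuter gains [K]. *)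
Definition target_gain K a : R := Num.max 0 (K - peak + schedule_cost a).

Lemma target_gain_ge0 K a : 0 <= target_gain K a.
Proof. by rewrite le_max lexx. Qed.

Lemma continuous_target_gain K : continuous (target_gain K).
Proof.
apply: max_fun_continuous => a; first exact: cvg_cst.
by apply: cvgD; [exact: cvg_cst|exact: continuous_schedule_cost].
Qed.

Lemma target_gain_outside K a : peak <= schedule_cost a -> 0 <= K ->
  K <= target_gain K a.
Proof. by move=> pa K0; rewrite le_max; apply/orP; right; lra. Qed.

Lemma target_gain_inside K a : 0 <= a <= T -> 0 <= K -> target_gain K a <= K.
Proof.
by move=> /schedule_cost_le_peak aT K0; rewrite ge_max K0/=; lra.
Qed.

Lemma target_gain0 K : 0 <= K -> target_gain K 0 = K.
Proof. by move=> K0; rewrite /target_gain schedule_cost0 subrK max_r. Qed.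

Lemma ler_target_gain K K' a : K <= K' -> target_gain K a <= target_gain K' a.
Proof.
move=> KK'; rewrite ge_max target_gain_ge0/=.
by rewrite le_max; apply/orP; right; lra.
Qed.

Lemma continuous_outlay_target_gain K :
  continuous (fun a => outlay (target_gain K a)).
Proof.
move=> a.
apply: (@cvg_comp _ _ _ (target_gain K) outlay).
  exact: continuous_target_gain.
exact: continuous_outlay.
Qed.

(** * Queue increments, continuity and arrivals *)

Section queue.
Variables r Q : R -> R.
Hypotheses (rate_r : departure_rate B r) (queue_Q : queue_of B r Q).

Lemma rate_ge0 t : 0 <= t <= T -> 0 <= r t.
Proof. by case: rate_r => r0 _ _ tT; apply: r0; rewrite in_itv. Qed.

Lemma rate_integrable : mu.-integrable `[0, T] (EFin \o r).
Proof. by case: rate_r. Qed.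

Lemma entries_cat u v w : 0 <= u -> u <= v -> v <= w -> w <= T ->
  entries r u w = entries r u v + entries r v w.
Proof.
move=> u0 uv vw wT; apply: Rintegral_cat => //.
exact: integrable_sub_itv rate_integrable.
Qed.

Lemma entries_ge0 u v : 0 <= u -> v <= T -> 0 <= entries r u v.
Proof.
move=> u0 vT; apply: Rintegral_ge0 => x; rewrite /= in_itv/= => /andP[ux xv].
by apply: rate_ge0; rewrite (le_trans u0 ux) (le_trans xv vT).
Qed.

Lemma queue_ge0 t : 0 <= t <= T -> 0 <= Q t.
Proof. by case: queue_Q => _ Q0 _ _ tT; apply: Q0; rewrite in_itv. Qed.

Lemma wait_ge0 t : 0 <= t <= T -> 0 <= wait B Q t.
Proof. by move=> tT; rewrite divr_ge0 ?queue_ge0// ltW. Qed.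

Lemma wait0 : wait B Q 0 = 0.
Proof. by case: queue_Q => Q0 _ _ _; rewrite /wait Q0 mul0r. Qed.

Lemma queue_busy t : 0 <= t <= T -> 0 < Q t -> exists that,
  [/\ 0 <= that < t, Q that = 0 & Q t = entries r that t - s * (t - that)].
Proof.
case: queue_Q => _ _ busy _ tT Qt; have [|v [v0t Qv _ Qte]] := busy t _ Qt.
  by rewrite in_itv.
by exists v.
Qed.

(** A nonempty queue at [u] is traced back to the start of its busy period; the service bound from
    there to [t] covers the entries since [u]. *)
Lemma queue_increment_ge u t : 0 <= u -> u <= t -> t <= T ->
  entries r u t - s * (t - u) <= Q t - Q u.
Proof.
move=> u0 ut tT; case: queue_Q => _ _ _ served.
have uT : u <= T := le_trans ut tT.
have : 0 <= Q u by rewrite queue_ge0// u0.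
rewrite le_eqVlt => /predU1P[<-|Qu]; first by rewrite subr0 served.
have [|v [/andP[v0 vu] _ ->]] := queue_busy _ Qu; first by rewrite u0.
have := served v t v0 (le_trans (ltW vu) ut) tT.
by rewrite (entries_cat v0 (ltW vu) ut tT); lra.
Qed.

(** If the busy period of [t] starts after [u], only entries since that start count in [Q t];
    otherwise the service bound from its start to [u] bounds [Q u] from below. *)
Lemma queue_increment_le u t : 0 <= u -> u <= t -> t <= T ->
  Q t - Q u <= entries r u t.
Proof.
move=> u0 ut tT; case: queue_Q => _ _ _ served.
have uT : u <= T := le_trans ut tT.
have t0 : 0 <= t := le_trans u0 ut.
have Qu : 0 <= Q u by rewrite queue_ge0// u0.
have ut0 := entries_ge0 u0 tT.
have : 0 <= Q t by rewrite queue_ge0// t0.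
rewrite le_eqVlt => /predU1P[<-|Qt]; first by lra.
have [|v [/andP[v0 vt] _ ->]] := queue_busy _ Qt; first by rewrite t0.
have [uv|vu] := leP u v.
  have uv0 := entries_ge0 u0 (le_trans (ltW vt) tT).
  have svt : 0 <= s * (t - v) by rewrite mulr_ge0 ?subr_ge0 ?ltW.
  by rewrite (entries_cat u0 uv (ltW vt) tT); lra.
have := served v u v0 (ltW vu) uT.
have sut : 0 <= s * (t - u) by rewrite mulr_ge0 ?subr_ge0// ltW.
by rewrite (entries_cat v0 (ltW vu) ut tT); lra.
Qed.

(** Increments of [Q] are squeezed between the entries minus the service and the entries; entries
    and service each take half of the tolerance. *)
Lemma continuous_queue : {within `[0, T], continuous Q}.
Proof.
have /within_continuousP cE :=
  parameterized_integral_continuous (ltW rush_end_gt0) rate_integrable.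
apply/within_continuousP => x xT e e0.
have [d1 d10 d1P] := cE x xT (e / 2) (divr_gt0 e0 (ltr0n R 2)).
have es : 0 < e / 2 / s by rewrite !divr_gt0.
exists (Num.min d1 (e / 2 / s)); first by rewrite lt_min d10.
have osc u t : 0 <= u -> u <= t -> t <= T -> t - u <= e / 2 / s ->
    entries r 0 t - entries r 0 u <= e / 2 -> `|Q t - Q u| <= e.
  move=> u0 ut tT tu; rewrite (entries_cat (lexx 0) u0 ut tT).
  have := queue_increment_le u0 ut tT; have := queue_increment_ge u0 ut tT.
  have := entries_ge0 u0 tT.
  have : s * (t - u) <= e / 2 by rewrite -ler_pdivlMl// mulrC.
  by move=> h1 h2 h3 h4 h5; rewrite ler_norml; apply/andP; split; lra.
move=> y yT; rewrite lt_min => /andP[xyd1 /ltW xyes].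
have := d1P y yT xyd1; rewrite -/(entries r 0 x) -/(entries r 0 y).
move: xT yT; rewrite /= !in_itv/= => /andP[x0 xT] /andP[y0 yT].
have [yx|/ltW xy] := leP y x => exy.
  by apply: osc => //; rewrite (le_trans (ler_norm _)).
by rewrite distrC; apply: osc => //;
  rewrite (le_trans (ler_norm _))// distrC.
Qed.

Lemma continuous_wait : {within `[0, T], continuous (wait B Q)}.
Proof.
apply: (within_continuous_comp (g := fun x => x / s) continuous_queue) => x.
by apply: cvgM; [exact: cvg_id|exact: cvg_cst].
Qed.

(* The sums [x + wait B Q x] are arrival times. *)
Lemma entries_le u t : 0 <= u -> u <= t -> t <= T ->
  entries r u t <= s * ((t + wait B Q t) - (u + wait B Q u)).
Proof.
move=> u0 ut tT; have := queue_increment_ge u0 ut tT.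
have sw x : s * wait B Q x = Q x.
  by rewrite /wait mulrCA divff ?mulr1// lt0r_neq0.
have := sw t; have := sw u; lra.
Qed.

(* The unused capacities of the three consecutive periods are nonnegative and
   their sum is [s * wait B Q T]. *)
Lemma entries_eq u t : wait B Q T = 0 -> 0 <= u -> u <= t -> t <= T ->
  entries r u t = s * ((t + wait B Q t) - (u + wait B Q u)).
Proof.
move=> wT u0 ut tT; apply/eqP; rewrite eq_le entries_le//=.
have := entries_le (lexx 0) u0 (le_trans ut tT).
have := entries_le (le_trans u0 ut) tT (lexx T).
rewrite wT wait0.
have eN : entries r 0 T = N by case: rate_r.
have := mass_rush; move: eN.
rewrite (entries_cat (lexx 0) u0 (le_trans ut tT) (lexx T)).
rewrite (entries_cat u0 ut tT (lexx T)); lra.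
Qed.

End queue.

Definition gain_at p t : R := perceived_gain (Num.max (p t) al).

Lemma gain_at_ge0 p t : 0 <= gain_at p t.
Proof. by apply: perceived_gain_ge0; rewrite le_max lexx orbT. Qed.

(** The budget of a flow at capacity over [[0, T]] in which a commuter arriving at [a] gains exactly
    [target_gain K a]. *)
Definition spending K : R :=
  s * \int[mu]_(a in `[0, T]) outlay (target_gain K a).

(** * Lower bound on the budget of an equilibrium *)

Section equilibria.
Variables p r Q : R -> R.
Hypotheses (p_ge0 : discount B p) (eq_pQ : equilibrium B p r Q).

Let rate_r : departure_rate B r. Proof. by case: eq_pQ. Qed.
Let queue_Q : queue_of B r Q. Proof. by case: eq_pQ. Qed.

(** The entry at time 0 meets no queue, which fixes the constant of the equilibrium. *)
Lemma equilibrium_cost t : 0 <= t <= T ->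
  entry_cost t (wait B Q t) = peak - gain_at p 0 + gain_at p t.
Proof.
have p0 x : 0 <= x <= T -> 0 <= p x by move=> xT; apply: p_ge0; rewrite in_itv.
case: eq_pQ => _ _ [Ce] cost tT.
have zT : (0 : R) <= 0 <= T by rewrite lexx ltW// rush_end_gt0.
have := cost t; have := cost 0.
rewrite !in_itv/= tT zT => /(_ isT) <- /(_ isT).
rewrite /total_cost !travel_costE !charging_costE ?p0//.
rewrite (wait0 queue_Q) entry_cost0 schedule_cost0 -!/(gain_at _ _); lra.
Qed.

(** Equilibrium equates the gain, up to a constant, with the entry cost, which is continuous because
    the wait is. This gives the integrability of the money spent although [p] is an arbitrary
    function. *)
Lemma continuous_gain_at : {within `[0, T], continuous (gain_at p)}.
Proof.
have /within_continuousP cE :=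
  continuous_entry_cost (continuous_wait rate_r queue_Q).
apply/within_continuousP => x xT e e0; have [d d0 dP] := cE x xT e e0.
exists d => // y yT xy; have := dP y yT xy.
rewrite !equilibrium_cost//.
by rewrite (_ : _ - _ = gain_at p x - gain_at p y)//; ring.
Qed.

(** Dropping the nonnegative waiting cost from the equilibrium equation bounds the gain below
    through the schedule cost at arrival. *)
Lemma target_gain_le_gain t : 0 <= t <= T ->
  target_gain (gain_at p 0) (t + wait B Q t) <= gain_at p t.
Proof.
move=> tT; rewrite ge_max gain_at_ge0/=.
have := equilibrium_cost tT; rewrite /entry_cost.
have aw : 0 <= al * wait B Q t.
  by rewrite mulr_ge0 ?(wait_ge0 queue_Q)// ltW// alpha_gt0.
lra.
Qed.

(** [D] is the shortfall of the outlay for an arrival relative to an arrival at time 0. Arrivals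
    have density at most [s], so the total shortfall is at most [s] times the integral of [D];
    removing it from [N * H 0] leaves the spending. *)
Lemma spending_le_budget : spending (gain_at p 0) <= monetary_budget B p r.
Proof.
set K := gain_at p 0; have K0 : 0 <= K := gain_at_ge0 p 0.
pose H a := outlay (target_gain K a).
pose D a := Num.max 0 (H 0 - H a).
have HE : H 0 = outlay K by rewrite /H target_gain0.
have T0 := ltW rush_end_gt0.
pose a t := t + wait B Q t.
have D0 x : 0 <= D x by rewrite le_max lexx.
have cH : continuous H by exact: continuous_outlay_target_gain.
have cHB : continuous (fun x => H 0 - H x).
  by move=> x; apply: cvgB; [exact: cvg_cst|exact: cH].
have cD : continuous D.
  by apply: max_fun_continuous => // x; exact: cvg_cst.
have ca : {within `[0, T], continuous a}.
  have /subspace_continuousP cw := continuous_wait rate_r queue_Q.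
  apply/subspace_continuousP => t tT.
  by apply: cvgD; [exact: cvg_within|exact: cw].
have intr := rate_integrable rate_r.
have intg : mu.-integrable `[0, T] (EFin \o (r \* (outlay \o gain_at p))).
  apply: integrableM_within_continuous => //.
  by apply: within_continuous_comp; [exact: continuous_gain_at
                                    |exact: continuous_outlay].
have intD : mu.-integrable `[0, T] (EFin \o (r \* (D \o a))).
  by apply: integrableM_within_continuous => //; exact: within_continuous_comp.
have intH : mu.-integrable `[0, T] (EFin \o (r \* cst (H 0))).
  apply: integrableM_within_continuous => //; apply: continuous_subspaceT => x.
  exact: cvg_cst.
have -> : monetary_budget B p r =
    \int[mu]_(t in `[0, T]) (r t * outlay (gain_at p t)).
  apply: eq_Rintegral_itv => t tT.
  by rewrite -mulrA outlayE_gain// p_ge0// in_itv.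
(* Each outlay is at least [H (a t)], hence at least [H 0 - D (a t)]. *)
have low : N * H 0 - \int[mu]_(t in `[0, T]) (r t * D (a t)) <=
    \int[mu]_(t in `[0, T]) (r t * outlay (gain_at p t)).
  have <- : \int[mu]_(t in `[0, T]) (r t * H 0) = N * H 0.
    by rewrite RintegralZr//; case: rate_r => _ _ <-.
  rewrite -RintegralB//; apply: le_Rintegral_itv => //.
    by apply: (integrableB _ intH intD).
  move=> t tT; rewrite -mulrBr ler_wpM2l ?(rate_ge0 rate_r)//.
  apply: (@le_trans _ _ (H (a t))).
    by rewrite lerBlDl -lerBlDr le_max lexx orbT.
  by apply: ler_outlay; [exact: target_gain_ge0|exact: target_gain_le_gain].
apply: le_trans low; rewrite lerBrDr -lerBrDl.
have aT : T <= a T by rewrite lerDl (wait_ge0 queue_Q)// lexx T0.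
have a0 : a 0 = 0 by rewrite /a (wait0 queue_Q) addr0.
(* After [T] the target gain is at least [K] and the shortfall vanishes; before [T] it is at most
   [K] and the shortfall is the plain difference. *)
have DT : \int[mu]_(x in `[0, a T]) D x = T * H 0 - \int[mu]_(x in `[0, T]) H x.
  rewrite (Rintegral_cat T0 aT (continuous_integrable _ _ cD)).
  rewrite [X in _ + X](_ : _ = 0); last first.
    transitivity (\int[mu]_(x in `[T, a T]) (0 : R)).
      apply: eq_Rintegral_itv => x /andP[Tx _]; rewrite /D max_l// subr_le0 HE.
      by apply: ler_outlay => //; apply: target_gain_outside => //;
        exact: schedule_cost_ge_peak.
    by rewrite Rintegral_itv_cst// mul0r.
  rewrite addr0 mulrC -[T in RHS](subr0 T) -(Rintegral_itv_cst (H 0) T0).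
  rewrite subr0 -RintegralB//.
  - apply: eq_Rintegral_itv => x xT; rewrite /D max_r// subr_ge0 HE.
    by apply: ler_outlay; [exact: target_gain_ge0|exact: target_gain_inside].
  - by apply: continuous_integrable => x; exact: cvg_cst.
  - exact: continuous_integrable.
have -> : N * H 0 - spending K = s * \int[mu]_(x in `[0, a T]) D x.
  by rewrite DT /spending -mass_rush /H; ring.
(* Dividing by [s] turns the capacity bound [entries_le] into the hypothesis of
   [Rintegral_comp_le]. *)
pose r' t := s^-1 * r t.
have intr' : mu.-integrable `[0, T] (EFin \o r').
  by apply: (integrableZl _ s^-1 intr).
have := @Rintegral_comp_le _ r' a D 0 T T0 _ intr' ca cD D0.
rewrite a0 => cmp.
have -> : \int[mu]_(t in `[0, T]) (r t * D (a t)) =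
    s * \int[mu]_(t in `[0, T]) (r' t * D (a t)).
  rewrite -RintegralZl//; last by apply: integrableM_within_continuous => //;
    exact: within_continuous_comp.
  apply: eq_Rintegral_itv => t _; rewrite /r' !mulrA divff ?mul1r//.
  exact: lt0r_neq0.
rewrite ler_pM2l//; apply: cmp => [t tT|u v u0 uv vT].
  by rewrite mulr_ge0 ?(rate_ge0 rate_r)// invr_ge0 ltW.
rewrite RintegralZl//; last exact: integrable_sub_itv intr.
by rewrite mulrC ler_pdivrMr// mulrC (entries_le rate_r queue_Q).
Qed.

End equilibria.

(** Otherwise the two ordered continuous integrands would coincide, in particular at time 0, where
    they are [outlay K] and [outlay K']. *)
Lemma ltr_spending K K' : 0 <= K -> K < K' -> spending K < spending K'.
Proof.
move=> K0 KK'; rewrite ltNge; apply/negP; rewrite /spending ler_pM2l// => le.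
have eqK := le_Rintegral_continuous_eq rush_end_gt0
  (continuous_subspaceT (@continuous_outlay_target_gain K))
  (continuous_subspaceT (@continuous_outlay_target_gain K')) _ le.
have : outlay (target_gain K 0) = outlay (target_gain K' 0).
  apply: eqK; last by rewrite lexx ltW// rush_end_gt0.
  move=> x _; apply: ler_outlay; first exact: target_gain_ge0.
  exact/ler_target_gain/ltW.
rewrite !target_gain0//; last exact: le_trans (ltW KK').
by have := ltr_outlay K0 KK' => /[swap] ->; rewrite ltxx.
Qed.

(** * The equilibrium with the least waiting *)

(** This and the next two definitions are [tl], [tr] and [t''] of the theorem in terms of the gain
    [K] of the first commuter; [punctual_entry 0] is [t']. *)
Definition congestion_start K : R := K / be.
Definition congestion_end K : R := T - K / ga.
Definition punctual_entry K : R := ts - (peak - K) / al.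

(** The two branches solve [entry_cost t w = peak - K] for an early and for a late arrival; they
    cross at [punctual_entry K]. *)
Definition balanced_wait K t : R :=
  Num.max 0 (Num.min (be * (t - congestion_start K) / (al - be))
                     (ga * (congestion_end K - t) / (al + ga))).

Definition balanced_rate K t : R :=
  if (t <= congestion_start K) || (congestion_end K <= t) then s
  else if t <= punctual_entry K then al * s / (al - be)
  else al * s / (al + ga).

Definition balanced_queue K t : R := s * balanced_wait K t.

(** * The balanced wait, rate and queue *)

Section balanced.
Variable K : R.
Hypotheses (K_ge0 : 0 <= K) (K_le_peak : K <= peak).

Local Notation t1 := (congestion_start K).
Local Notation t2 := (congestion_end K).
Local Notation tp := (punctual_entry K).

Let a_gt0 := alpha_gt0.
Let g_gt0 := gamma_gt0.
Let al_sub_be_gt0 : 0 < al - be. Proof. by rewrite subr_gt0. Qed.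
Let al_add_ga_gt0 : 0 < al + ga. Proof. exact: addr_gt0. Qed.
Let be_t1 : be * t1 = K.
Proof. by rewrite /congestion_start mulrCA divff ?mulr1// lt0r_neq0. Qed.
Let ga_t2 : ga * (T - t2) = K.
Proof. by rewrite /congestion_end subKr mulrCA divff ?mulr1// lt0r_neq0. Qed.
Let al_tp : al * (ts - tp) = peak - K.
Proof. by rewrite /punctual_entry subKr mulrCA divff ?mulr1// lt0r_neq0. Qed.
Let early_cost : be * (ts - t1) = peak - K.
Proof. by rewrite mulrBr be_t1. Qed.
Let late_cost : ga * (t2 - ts) = peak - K.
Proof. by rewrite -peak_late -{2}ga_t2 -mulrBr; congr (_ * _); ring. Qed.

Let t1_ge0 : 0 <= t1. Proof. by rewrite divr_ge0// ltW. Qed.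
Let t2_le : t2 <= T. Proof. by rewrite gerBl divr_ge0// ltW. Qed.
Let tp_le_ts : tp <= ts.
Proof. by rewrite -subr_ge0 -(pmulr_rge0 _ a_gt0) al_tp subr_ge0. Qed.
Let ts_le_t2 : ts <= t2.
Proof. by rewrite -subr_ge0 -(pmulr_rge0 _ g_gt0) late_cost subr_ge0. Qed.
Let t1_le_tp : t1 <= tp.
Proof.
rewrite -subr_ge0 -(pmulr_rge0 _ beta_gt0).
have h : 0 <= (al - be) * (ts - tp) by rewrite mulr_ge0 ?subr_ge0// ltW.
have := al_tp; have := early_cost; lra.
Qed.
Let tp_le_t2 : tp <= t2. Proof. exact: le_trans ts_le_t2. Qed.

(** Expanded around [tp], this branch and the late one share the value [(peak - K) / al] and have
    slopes of opposite signs, which decides their minimum. *)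
Let early_branch t : be * (t - t1) / (al - be) =
  (peak - K) / al + be / (al - be) * (t - tp).
Proof.
rewrite -early_cost /punctual_entry -early_cost.
by field; rewrite !lt0r_neq0.
Qed.

Let late_branch t : ga * (t2 - t) / (al + ga) =
  (peak - K) / al - ga / (al + ga) * (t - tp).
Proof.
rewrite -[t2](subrK ts) -[t2 - ts](mulKf (lt0r_neq0 g_gt0)) late_cost.
rewrite /punctual_entry.
by field; rewrite !lt0r_neq0.
Qed.

Lemma balanced_wait_ge0 t : 0 <= balanced_wait K t.
Proof. by rewrite le_max lexx. Qed.

Lemma balanced_wait_before t : t <= t1 -> balanced_wait K t = 0.
Proof.
move=> tt1; apply/max_l; rewrite ge_min; apply/orP; left.
by rewrite pmulr_lle0 ?invr_gt0// pmulr_rle0// subr_le0.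
Qed.

Lemma balanced_wait_after t : t2 <= t -> balanced_wait K t = 0.
Proof.
move=> tt2; apply/max_l; rewrite ge_min; apply/orP; right.
by rewrite pmulr_lle0 ?invr_gt0// pmulr_rle0// subr_le0.
Qed.

Lemma balanced_wait_early t : t1 <= t <= tp ->
  balanced_wait K t = be * (t - t1) / (al - be).
Proof.
move=> /andP[t1t ttp]; rewrite /balanced_wait min_l.
  by rewrite max_r// divr_ge0 ?mulr_ge0 ?subr_ge0// ltW.
rewrite early_branch late_branch lerD2l -subr_ge0 -opprD -mulrDl -mulrN opprB.
by rewrite mulr_ge0 ?subr_ge0// addr_ge0// divr_ge0// ltW.
Qed.

Lemma balanced_wait_late t : tp <= t <= t2 ->
  balanced_wait K t = ga * (t2 - t) / (al + ga).
Proof.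
move=> /andP[tpt tt2]; rewrite /balanced_wait min_r.
  by rewrite max_r// divr_ge0 ?mulr_ge0 ?subr_ge0// ltW.
rewrite early_branch late_branch lerD2l -subr_ge0 opprK -mulrDl.
by rewrite mulr_ge0 ?subr_ge0// addr_ge0// divr_ge0// ltW.
Qed.

Lemma balanced_wait_gt0 t : t1 < t < t2 -> 0 < balanced_wait K t.
Proof.
move=> /andP[t1t tt2]; rewrite lt_max lt_min; apply/orP; right.
by apply/andP; split; rewrite divr_gt0 ?mulr_gt0 ?subr_gt0.
Qed.

(** Outside []t1, t2[] the schedule cost alone is at least [peak - K]; inside, the active branch
    gives the cost [peak - K] once the arrival is shown to fall on the right side of [ts]. *)
Lemma balanced_entry_cost t :
  entry_cost t (balanced_wait K t) = Num.max (peak - K) (schedule_cost t).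
Proof.
have [tt1|t1t] := leP t t1.
  rewrite balanced_wait_before// entry_cost0 max_r//.
  rewrite -early_cost le_max; apply/orP; left.
  by rewrite ler_pM2l// lerB.
have [t2t|tt2] := leP t2 t.
  rewrite balanced_wait_after// entry_cost0 max_r//.
  rewrite -late_cost le_max mulNr -mulrN opprB; apply/orP; right.
  by rewrite ler_pM2l// lerB.
rewrite max_l; last first.
  rewrite ge_max -{1}early_cost -late_cost mulNr -mulrN opprB !ler_pM2l//.
  by rewrite !lerB// ltW.
have [ttp|tpt] := leP t tp.
  have tE : t1 <= t <= tp by rewrite ltW.
  have wE := balanced_wait_early tE; set w := balanced_wait K t in wE *.
  have wm : (al - be) * w = be * (t - t1).
    by rewrite wE mulrC divfK// lt0r_neq0.
  have tw : t + w <= ts.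
    have h : (al - be) * (t + w - ts) <= 0.
      have h1 : al * (t - tp) <= 0 by rewrite pmulr_rle0// subr_le0.
      have := al_tp; have := early_cost; lra.
    by move: h; rewrite pmulr_rle0// subr_le0.
  rewrite /entry_cost schedule_costE tw; have := early_cost; lra.
have tE : tp <= t <= t2 by rewrite !ltW.
have wE := balanced_wait_late tE; set w := balanced_wait K t in wE *.
have wm : (al + ga) * w = ga * (t2 - t).
  by rewrite wE mulrC divfK// lt0r_neq0.
have tw : ts <= t + w.
  have h : 0 <= (al + ga) * (t + w - ts).
    have h1 : 0 <= al * (t - tp) by rewrite pmulr_rge0// subr_ge0 ltW.
    have := al_tp; have := late_cost; lra.
  by move: h; rewrite pmulr_rge0// subr_ge0.
(* [schedule_costE] counts an arrival exactly at [ts] as early, so this boundary case is treated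
   apart. *)
rewrite /entry_cost schedule_costE; have [twE|_] := leP (t + w) ts.
  have -> : t + w = ts by apply/eqP; rewrite eq_le tw twE.
  have : t = ts - w by apply/eqP; rewrite eq_sym subr_eq eq_sym eq_le tw twE.
  move=> /(congr1 ( *%R ga)); rewrite subrr mulr0 addr0; have := late_cost; lra.
have := late_cost; lra.
Qed.

Lemma target_gain_before t : t <= t1 -> target_gain K t = K - be * t.
Proof.
move=> tt1; have bt := be_t1; have ec := early_cost.
have bt1 : 0 <= be * (t1 - t) by rewrite pmulr_rge0// subr_ge0.
have tts : t <= ts.
  by rewrite (le_trans tt1)// (le_trans t1_le_tp).
by rewrite /target_gain schedule_costE tts max_r; lra.
Qed.

Lemma target_gain_after t : t2 <= t -> target_gain K t = ga * t - ga * t2.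
Proof.
move=> t2t; have lc := late_cost.
have gt2 : 0 <= ga * (t - t2) by rewrite pmulr_rge0// subr_ge0.
(* The first case occurs only if [t], [ts] and [t2] coincide, which forces [K = peak]. *)
rewrite /target_gain schedule_costE; have [tts|_] := leP t ts.
  have -> : t = t2 by apply/eqP; rewrite eq_le t2t (le_trans tts).
  have ets : ts = t2 by apply/eqP; rewrite eq_le ts_le_t2 (le_trans t2t).
  by move: lc; rewrite ets !subrr !mulr0 addr0 => lc; rewrite max_l; lra.
by rewrite max_r; lra.
Qed.

Lemma target_gain_between t : t1 <= t <= t2 -> target_gain K t = 0.
Proof.
move=> /andP[t1t tt2]; apply: max_l.
have ec := early_cost; have lc := late_cost.
have h1 : 0 <= be * (t - t1) by rewrite pmulr_rge0// subr_ge0.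
have h2 : 0 <= ga * (t2 - t) by rewrite pmulr_rge0// subr_ge0.
by rewrite schedule_costE; have [_|_] := leP t ts; lra.
Qed.

(** The rate departs from [s] only where the target gain vanishes and no money is paid. *)
Lemma balanced_rate_outlay t :
  balanced_rate K t * outlay (target_gain K t) = s * outlay (target_gain K t).
Proof.
rewrite /balanced_rate; case: ifPn => //.
rewrite negb_or -!ltNge => /andP[t1t tt2].
by rewrite target_gain_between ?outlay0 ?mulr0// !ltW.
Qed.

(** The target gain falls from [K] to 0 at rate [be], stays there, and climbs back to [K] at rate
    [ga]: affine substitutions treat the outer parts, and [h 0 = 0] removes the middle one. *)
Lemma Rintegral_target_gain (h : R -> R) : continuous h -> h 0 = 0 ->
  \int[mu]_(a in `[0, T]) h (target_gain K a) =
  (be^-1 + ga^-1) * \int[mu]_(c in `[0, K]) h c.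
Proof.
move=> ch h0.
have chk : continuous (fun a => h (target_gain K a)).
  move=> a; apply: (@cvg_comp _ _ _ (target_gain K) h); last exact: ch.
  exact: continuous_target_gain.
have t1_le_t2 : t1 <= t2 by rewrite (le_trans t1_le_tp).
rewrite (@Rintegral_cat _ _ 0 t1 T) ?(le_trans t1_le_t2)//; last first.
  exact: continuous_integrable.
rewrite (@Rintegral_cat _ _ t1 t2 T)//; last exact: continuous_integrable.
have -> : \int[mu]_(a in `[t1, t2]) h (target_gain K a) = 0.
  transitivity (\int[mu]_(a in `[t1, t2]) (0 : R)).
    by apply: eq_Rintegral_itv => a at12; rewrite target_gain_between.
  by rewrite Rintegral_itv_cst// mul0r.
have -> : \int[mu]_(a in `[0, t1]) h (target_gain K a) =
    be^-1 * \int[mu]_(c in `[0, K]) h c.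
  transitivity (\int[mu]_(a in `[0, t1]) h (K - be * a)).
    by apply: eq_Rintegral_itv => a /andP[_ at1]; rewrite target_gain_before.
  have := Rintegral_affine_decr K beta_gt0 t1_ge0 ch.
  by rewrite be_t1 subrr mulr0 subr0 => ->; rewrite mulKf// lt0r_neq0.
have -> : \int[mu]_(a in `[t2, T]) h (target_gain K a) =
    ga^-1 * \int[mu]_(c in `[0, K]) h c.
  transitivity (\int[mu]_(a in `[t2, T]) h (ga * a + - (ga * t2))).
    by apply: eq_Rintegral_itv => a /andP[t2a _]; rewrite target_gain_after.
  have := Rintegral_affine_incr (- (ga * t2)) g_gt0 t2_le ch.
  by rewrite subrr -mulrBr ga_t2 => ->; rewrite mulKf// lt0r_neq0.
by rewrite add0r mulrDl.
Qed.

(** Adding the three possible values gives a crude bound, sufficient for integrability. *)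
Lemma balanced_rate_bounded t :
  `|balanced_rate K t| <= s + al * s / (al - be) + al * s / (al + ga).
Proof.
have h1 : 0 <= al * s / (al - be) by rewrite divr_ge0 ?mulr_ge0// ltW.
have h2 : 0 <= al * s / (al + ga) by rewrite divr_ge0 ?mulr_ge0// ltW.
have s0 := ltW capacity_gt0.
rewrite /balanced_rate; case: ifP => _; last case: ifP => _;
  rewrite ger0_norm//; lra.
Qed.

Lemma balanced_rate_ge0 t : 0 <= balanced_rate K t.
Proof.
have s0 := ltW capacity_gt0.
rewrite /balanced_rate; case: ifP => _ //.
by case: ifP => _; rewrite divr_ge0 ?mulr_ge0// ltW.
Qed.

(** Cutting at [t1], [tp] and [t2] leaves four pieces on which the rate is constant and the wait
    affine. *)
Lemma balanced_primitive :
  primitive_on (balanced_rate K) (fun t => s * (t + balanced_wait K t)) 0 T.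
Proof.
have bound := balanced_rate_bounded.
apply: (primitive_on_cat bound t1_ge0).
- by rewrite (le_trans t1_le_tp)// (le_trans tp_le_t2).
- apply: (@primitive_on_cst _ _ _ _ _ s 0) => x /andP[x0 xt1].
    by rewrite /balanced_rate (ltW xt1).
  by rewrite balanced_wait_before ?addr0.
apply: (primitive_on_cat bound t1_le_tp); first exact: le_trans tp_le_t2 _.
  apply: (@primitive_on_cst _ _ _ _ _ (al * s / (al - be))
            (- (s * be * t1 / (al - be)))) => x /andP[t1x xtp].
    rewrite /balanced_rate !leNgt t1x (lt_le_trans xtp tp_le_t2)/=.
    by rewrite -leNgt ltW.
  by rewrite balanced_wait_early ?t1x// ; field; rewrite lt0r_neq0.
apply: (primitive_on_cat bound tp_le_t2) => //.
  apply: (@primitive_on_cst _ _ _ _ _ (al * s / (al + ga))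
            (s * ga * t2 / (al + ga))) => x /andP[tpx xt2].
    by rewrite /balanced_rate !leNgt xt2 (le_lt_trans t1_le_tp tpx)/= tpx.
  by rewrite balanced_wait_late ?tpx//; field; rewrite lt0r_neq0.
apply: (@primitive_on_cst _ _ _ _ _ s 0) => x /andP[t2x xT].
  by rewrite /balanced_rate (ltW t2x) orbT.
by rewrite balanced_wait_after ?addr0.
Qed.

Lemma balanced_entries u t : 0 <= u -> u <= t -> t <= T ->
  entries (balanced_rate K) u t =
  s * ((t + balanced_wait K t) - (u + balanced_wait K u)).
Proof.
by move=> u0 ut tT; have [_] := balanced_primitive u0 ut tT; rewrite mulrBr.
Qed.

Lemma balanced_departure_rate : departure_rate B (balanced_rate K).
Proof.
have T0 := ltW rush_end_gt0.
split.
- by move=> t _; exact: balanced_rate_ge0.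
- have [m _] := balanced_primitive (lexx 0) T0 (lexx T).
  exact: bounded_integrable_itv balanced_rate_bounded m.
- rewrite balanced_entries// balanced_wait_after// balanced_wait_before//.
  by rewrite !addr0 subr0 mass_rush.
Qed.

Lemma wait_balanced_queue t : wait B (balanced_queue K) t = balanced_wait K t.
Proof. by rewrite /wait /balanced_queue mulrC mulKf// lt0r_neq0. Qed.

Lemma balanced_queue_of : queue_of B (balanced_rate K) (balanced_queue K).
Proof.
split.
- by rewrite /balanced_queue balanced_wait_before// mulr0.
- by move=> t _; rewrite mulr_ge0 ?balanced_wait_ge0// ltW.
- move=> t; rewrite in_itv/= => /andP[t0 tT].
  rewrite /balanced_queue pmulr_rgt0// => wt.
  have t1t : t1 < t.
    rewrite ltNge; apply/negP => /balanced_wait_before w0.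
    by rewrite w0 ltxx in wt.
  have tt2 : t < t2.
    rewrite ltNge; apply/negP => /balanced_wait_after w0.
    by rewrite w0 ltxx in wt.
  (* All the congestion forms a single busy period, starting at [t1]. *)
  exists t1; split.
  + by rewrite t1_ge0.
  + by rewrite balanced_wait_before// mulr0.
  + move=> u /andP[t1u ut].
    by rewrite mulr_gt0// balanced_wait_gt0// t1u (le_lt_trans ut).
  + rewrite balanced_entries ?(ltW t1t)//.
    by rewrite [balanced_wait K t1]balanced_wait_before//; ring.
- move=> u t u0 ut tT; rewrite balanced_entries// /balanced_queue.
  have : 0 <= s * balanced_wait K u.
    by rewrite mulr_ge0 ?balanced_wait_ge0// ltW.
  lra.
Qed.

End balanced.

(** * Equilibria under a discount with the target gain *)

Section balanced_discount.
Variables (p : R -> R) (K : R).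
Hypotheses (K_ge0 : 0 <= K) (K_le_peak : K <= peak) (p_ge0 : discount B p)
  (gain_p : forall t, 0 <= t <= T -> gain_at p t = target_gain K t).

Let zero_in : (0 : R) <= 0 <= T.
Proof. by rewrite lexx ltW// rush_end_gt0. Qed.

Lemma balanced_cost t : peak - K + target_gain K t =
  Num.max (peak - K) (schedule_cost t).
Proof. by rewrite /target_gain addr_maxr addr0; congr Num.max; ring. Qed.

Lemma balanced_equilibrium :
  equilibrium B p (balanced_rate K) (balanced_queue K).
Proof.
split; [exact: balanced_departure_rate|exact: balanced_queue_of|].
exists (peak - K + db * pbar B) => t; rewrite in_itv/= => tT.
rewrite /total_cost travel_costE wait_balanced_queue// balanced_entry_cost//.
rewrite charging_costE; last by apply: p_ge0; rewrite in_itv.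
by rewrite -/(gain_at p t) gain_p// -balanced_cost; ring.
Qed.

(** The gains fix the entry cost, and the entry cost determines the wait. *)
Lemma balanced_wait_unique r Q t : equilibrium B p r Q -> 0 <= t <= T ->
  wait B Q t = balanced_wait K t.
Proof.
move=> eqQ tT; apply: (@entry_cost_inj t).
rewrite (equilibrium_cost p_ge0 eqQ tT) !gain_p//.
by rewrite target_gain0// balanced_cost balanced_entry_cost.
Qed.

Lemma balanced_on_time : unique (on_time_entry B p) (punctual_entry K).
Proof.
have a0 := alpha_gt0; have a0' := lt0r_neq0 a0.
have D0 : 0 <= peak - K by rewrite subr_ge0.
have Dt : (peak - K) / al <= ts.
  rewrite ler_pdivrMr// (@le_trans _ _ peak) ?gerBl//.
  by rewrite /peak mulrC ler_pM2l ?tstar_gt0// ltW.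
have tpT : 0 <= punctual_entry K <= T.
  rewrite subr_ge0 Dt/= (le_trans _ (ltW tstar_lt_rush_end))// gerBl.
  by rewrite divr_ge0// ltW.
have wtp : balanced_wait K (punctual_entry K) = (peak - K) / al.
  apply: (@entry_cost_inj (punctual_entry K)); rewrite balanced_entry_cost//.
  rewrite /entry_cost subrK schedule_cost_tstar addr0 mulrCA divff// mulr1.
  rewrite max_l// schedule_costE gerBl divr_ge0 ?(ltW a0)//.
  rewrite subKr mulrA ler_pdivrMr// mulrC ler_wpM2l//.
  exact: ltW.
split.
  split; first by rewrite in_itv.
  exists (balanced_rate K), (balanced_queue K).
  split; first exact: balanced_equilibrium.
  by rewrite wait_balanced_queue// wtp subrK.
move=> t [+ [r [Q [eqQ tw]]]]; rewrite in_itv/= => tT.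
have eqQ' := balanced_wait_unique eqQ tT.
have := balanced_entry_cost K t.
rewrite -eqQ' /entry_cost tw schedule_cost_tstar addr0.
have w0 : 0 <= wait B Q t by rewrite eqQ' balanced_wait_ge0.
have tE : t = ts - wait B Q t by rewrite -tw addrK.
have -> : schedule_cost t = be * wait B Q t.
  by rewrite schedule_costE {1}tE gerBl w0 {1}tE subKr.
(* Since [be < al], the maximum can be [be] times the wait only if the wait is 0, and then
   [peak - K] vanishes too. *)
move=> aw; have {}aw : al * wait B Q t = peak - K.
  move: aw; have [Dw|wD//] := leP (peak - K) (be * wait B Q t) => aw.
  have : (al - be) * wait B Q t = 0 by rewrite mulrBl aw subrr.
  move/eqP; rewrite mulf_eq0 subr_eq0 gt_eqF//= => /eqP w0'.
  move: Dw; rewrite w0' !mulr0 => D0'.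
  by apply/eqP; rewrite eq_le D0 D0'.
by rewrite {1}tE /punctual_entry -aw mulrC mulKf.
Qed.

(** The waits agree and the queue is empty at [T], so the cumulative entries agree; they determine
    the rate almost everywhere. *)
Lemma balanced_rate_unique r Q : equilibrium B p r Q ->
  {ae mu, forall t, t \in `[0, T] -> r t = balanced_rate K t}.
Proof.
move=> eqQ; have [rate_r queue_Q _] := eqQ.
have T0 := ltW rush_end_gt0.
apply: Rintegral_eq_ae.
- exact: rate_integrable rate_r.
- by apply: rate_integrable; exact: balanced_departure_rate.
move=> x /andP[x0 xT].
have wT : wait B Q T = 0.
  rewrite (balanced_wait_unique eqQ) ?lexx ?T0// balanced_wait_after//.
  by rewrite gerBl divr_ge0// ltW// gamma_gt0.
rewrite -[LHS]/(entries r 0 x) -[RHS]/(entries (balanced_rate K) 0 x).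
rewrite (entries_eq rate_r queue_Q)// balanced_entries//.
by rewrite !(balanced_wait_unique eqQ)// x0.
Qed.

End balanced_discount.

(** * Optimality and uniqueness of the discount *)

Section optimality.
Variables (p : R -> R) (K : R).
Hypotheses (K_ge0 : 0 <= K) (K_le_peak : K <= peak) (p_ge0 : discount B p)
  (gain_p : forall t, 0 <= t <= T -> gain_at p t = target_gain K t).

Lemma balanced_budget : monetary_budget B p (balanced_rate K) = spending K.
Proof.
rewrite /spending -RintegralZl//; last first.
  by apply: continuous_integrable; exact: continuous_outlay_target_gain.
apply: eq_Rintegral_itv => t tT.
rewrite -mulrA outlayE_gain; last by apply: p_ge0; rewrite in_itv.
by rewrite -/(gain_at p t) gain_p// balanced_rate_outlay.
Qed.

(** A larger first gain would require strictly more than the available budget. *)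
Lemma feasible_gain0 q r Q : feasible B (spending K) q r Q -> gain_at q 0 <= K.
Proof.
move=> [q0 eqQ bud]; rewrite leNgt; apply/negP => /(ltr_spending K_ge0).
by apply/negP; rewrite -leNgt (le_trans _ bud)// (spending_le_budget q0 eqQ).
Qed.

(** The entry cost is at least [peak - K] by the bound on the first gain, and at least the schedule
    cost since waits are nonnegative; the balanced wait attains the larger of the two. *)
Lemma balanced_wait_le q r Q t : feasible B (spending K) q r Q ->
  0 <= t <= T -> balanced_wait K t <= wait B Q t.
Proof.
move=> feas tT; have c0K := feasible_gain0 feas; have [q0 eqQ _] := feas.
have [rate_r queue_Q _] := eqQ.
apply: (@ler_entry_cost t); rewrite balanced_entry_cost// ge_max.
apply/andP; split.
  by rewrite (equilibrium_cost q0 eqQ tT); have := gain_at_ge0 q t; lra.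
rewrite -entry_cost0; have := wait_ge0 queue_Q tT.
by rewrite le_eqVlt => /predU1P[<-//|/(ltr_entry_cost t)/ltW].
Qed.

Let integrable_wait r Q : departure_rate B r -> queue_of B r Q ->
  mu.-integrable `[0, T] (EFin \o wait B Q).
Proof.
move=> rate_r queue_Q; apply: within_continuous_integrable.
exact: continuous_wait rate_r queue_Q.
Qed.

Lemma balanced_optimal :
  optimal B (spending K) p (balanced_rate K) (balanced_queue K).
Proof.
split.
  split=> //; first exact: balanced_equilibrium K_ge0 K_le_peak p_ge0 gain_p.
  by rewrite balanced_budget.
move=> q r Q feas; have [_ [rate_r queue_Q _] _] := feas.
apply: le_Rintegral_itv; [|exact: (integrable_wait rate_r queue_Q)|].
  apply: (integrable_wait (balanced_departure_rate K_ge0 K_le_peak)).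
  exact: balanced_queue_of.
by move=> t tT; rewrite wait_balanced_queue//; exact: balanced_wait_le feas tT.
Qed.

(** Ordered continuous waits with the same integral coincide, so the gains agree up to a constant.
    Discounts below [al] induce no charging, hence the truncation in the conclusion. *)
Lemma optimal_unique q r Q : optimal B (spending K) q r Q ->
  forall t, 0 <= t <= T -> Num.max (q t) al = Num.max (p t) al.
Proof.
move=> [feas opt] t tT; have [q0 eqQ _] := feas; have [rate_r queue_Q _] := eqQ.
have wE x : 0 <= x <= T -> balanced_wait K x = wait B Q x.
  move=> xT; rewrite -wait_balanced_queue//.
  apply: (le_Rintegral_continuous_eq rush_end_gt0 _ _ _ _ xT).
  - apply: (continuous_wait (balanced_departure_rate K_ge0 K_le_peak)).
    exact: balanced_queue_of.
  - exact: continuous_wait rate_r queue_Q.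
  - move=> y yT; rewrite wait_balanced_queue//.
    exact: balanced_wait_le feas yT.
  - by have [+ _] := balanced_optimal; exact: opt.
have costE x : 0 <= x <= T ->
    peak - K + target_gain K x = peak - gain_at q 0 + gain_at q x.
  move=> xT; rewrite balanced_cost -balanced_entry_cost// wE//.
  exact: (equilibrium_cost q0 eqQ xT).
(* The budget gives one inequality. For the other, at [ts] the target gain is 0 and the gain under
   [q] is nonnegative. *)
have c0 : gain_at q 0 = K.
  apply/eqP; rewrite eq_le (feasible_gain0 feas)/=.
  have := costE ts; rewrite (ltW tstar_gt0) (ltW tstar_lt_rush_end).
  move=> /(_ isT); have := gain_at_ge0 q ts; have := target_gain_ge0 K ts.
  rewrite {2}/target_gain schedule_cost_tstar addr0 max_l ?subr_le0//; lra.
have gE : gain_at q t = gain_at p t.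
  by rewrite gain_p//; have := costE t tT; lra.
rewrite -(@discount_of_gain (Num.max (q t) al)) ?le_max ?lexx ?orbT//.
by rewrite -/(gain_at q t) gE discount_of_gain// le_max lexx orbT.
Qed.

End optimality.

(** * Monetary and perceived budgets in terms of the first gain *)

Section budgets.

Lemma peakE : peak = be * ga * N / (s * (be + ga)).
Proof. by rewrite /peak /tstar -!mulrA. Qed.

Lemma spendingE K : 0 <= K -> K <= peak ->
  spending K = s * (be^-1 + ga^-1) * \int[mu]_(c in `[0, K]) outlay c.
Proof.
move=> K0 Kp; rewrite /spending Rintegral_target_gain//; first by rewrite mulrA.
  exact: continuous_outlay.
exact: outlay0.
Qed.

Lemma spending_surj M : 0 <= M -> M <= spending peak ->
  exists2 K, 0 <= K <= peak & spending K = M.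
Proof.
move=> M0 Mp; have pk := ltW peak_gt0.
pose V K := s * (be^-1 + ga^-1) * \int[mu]_(c in `[0, K]) outlay c.
have cV : {within `[0, peak], continuous V}.
  apply: (within_continuous_comp (g := fun x => s * (be^-1 + ga^-1) * x)).
    apply: parameterized_integral_continuous => //.
    by apply: continuous_integrable; exact: continuous_outlay.
  by move=> x; apply: cvgM; [exact: cvg_cst|exact: cvg_id].
have V0 : V 0 = 0 by rewrite /V set_itv1 Rintegral_set1 mulr0.
have Vp : V peak = spending peak by rewrite spendingE.
have [|K] := IVT pk cV (v := M).
  by rewrite V0 Vp min_l ?(le_trans M0)// max_r ?M0// (le_trans M0).
rewrite in_itv/= => /andP[K0 Kp] VK; exists K; first by rewrite K0.
by rewrite spendingE.
Qed.

(** For [0 <= K <= peak], [s] times the area under [target_gain K] on [[0, T]]: two triangles of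
    height [K] with slopes [be] and [ga]. *)
Definition perceived_of_gain K : R := s * (be + ga) * K ^+ 2 / (2 * be * ga).

(** The excess of the money over the perceived gain, in the form met in [budget_of_perceived];
    [outlay_sub_discount] has the form met in [full_budget]. *)
Lemma outlay_sub c : outlay c - c =
  db * Num.sqrt ((db^-1 * c + al) ^+ 2 - al ^+ 2).
Proof.
rewrite /outlay /discount_of mulNr opprK -opprD sqrrN [db^-1 * c]mulrC.
by move: (Num.sqrt _) => S; field; rewrite lt0r_neq0.
Qed.

Lemma outlay_sub_discount c : 0 <= c -> outlay c - c = db *
  ((discount_of B (- c) ^+ 2 - al ^+ 2) / (2 * discount_of B (- c))).
Proof.
move=> c0; rewrite -{2}(perceived_gain_discount_of c0) /outlay /perceived_gain.
have := lt_le_trans alpha_gt0 (discount_of_ge c0).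
by move: (discount_of B (- c)) => P P0; field; rewrite lt0r_neq0.
Qed.

Lemma continuous_outlay_sub : continuous (fun c => outlay c - c).
Proof.
by move=> c; apply: cvgB; [exact: continuous_outlay|exact: cvg_id].
Qed.

Lemma Rintegral_id K : 0 <= K -> \int[mu]_(c in `[0, K]) c = K ^+ 2 / 2.
Proof.
move=> K0; rewrite -[LHS](_ : \int[mu]_(c in `[0, K]) (1 * c + 0) = _).
  by rewrite Rintegral_affine//; field.
by apply: eq_Rintegral => c _; rewrite mul1r addr0.
Qed.

Lemma spending_split K : 0 <= K -> K <= peak -> spending K =
  perceived_of_gain K +
  s * (be^-1 + ga^-1) * \int[mu]_(c in `[0, K]) (outlay c - c).
Proof.
move=> K0 Kp; rewrite spendingE// RintegralB//; last 2 first.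
- by apply: continuous_integrable; exact: continuous_outlay.
- by apply: (@continuous_integrable _ id) => x; exact: cvg_id.
rewrite Rintegral_id// /perceived_of_gain; field.
by rewrite !lt0r_neq0// gamma_gt0.
Qed.

Lemma left_time_gain K : 0 <= K ->
  left_time B (perceived_of_gain K) = congestion_start K.
Proof.
move=> K0; rewrite /left_time /perceived_of_gain.
have -> : 2 * ga * (s * (be + ga) * K ^+ 2 / (2 * be * ga)) /
    (s * be * (be + ga)) = (K / be) ^+ 2.
  by field; rewrite !lt0r_neq0 ?addr_gt0 ?gamma_gt0.
by rewrite sqrtr_sqr ger0_norm// divr_ge0// ltW.
Qed.

Lemma right_time_gain K : 0 <= K ->
  right_time B (perceived_of_gain K) = congestion_end K.
Proof.
move=> K0; rewrite /right_time /perceived_of_gain.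
have -> : 2 * be * (s * (be + ga) * K ^+ 2 / (2 * be * ga)) /
    (s * ga * (be + ga)) = (K / ga) ^+ 2.
  by field; rewrite !lt0r_neq0 ?addr_gt0 ?gamma_gt0.
by rewrite sqrtr_sqr ger0_norm// divr_ge0// ltW// gamma_gt0.
Qed.

(** The substitution [y = al + c / db] turns both integrals of the map into one and the same
    integral over [[0, K]]. *)
Lemma budget_of_perceived_gain K : 0 <= K -> K <= peak ->
  budget_of_perceived B (perceived_of_gain K) = spending K.
Proof.
move=> K0 Kp; rewrite spending_split// /budget_of_perceived.
rewrite left_time_gain// right_time_gain//.
rewrite /congestion_end subKr /congestion_start.
have -> : be / db * (K / be) = db^-1 * K by field; rewrite !lt0r_neq0.
have -> : ga / db * (K / ga) = db^-1 * K.
  by field; rewrite !lt0r_neq0// gamma_gt0.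
have cS : continuous (fun y : R => 2 * Num.sqrt (y ^+ 2 - al ^+ 2)).
  move=> y; apply: cvgM; first exact: cvg_cst.
  apply: (@cvg_comp _ _ _ _ (@Num.sqrt R)); last exact: sqrt_continuous.
  by apply: cvgB; [exact: exprn_continuous|exact: cvg_cst].
have dbV0 : 0 < db^-1 by rewrite invr_gt0.
have := Rintegral_affine_incr al dbV0 K0 cS.
rewrite mulr0 add0r addrC => ->.
have -> : \int[mu]_(x in `[0, K])
      (2 * Num.sqrt ((db^-1 * x + al) ^+ 2 - al ^+ 2)) =
    2 / db * \int[mu]_(c in `[0, K]) (outlay c - c).
  rewrite -RintegralZl//; last first.
    by apply: continuous_integrable; exact: continuous_outlay_sub.
  apply: eq_Rintegral => c _; rewrite outlay_sub mulrA.
  by congr (_ * _); field; rewrite lt0r_neq0.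
by congr (_ + _); field; rewrite !lt0r_neq0// gamma_gt0.
Qed.

Lemma full_perceivedE : full_perceived B = perceived_of_gain peak.
Proof.
rewrite /full_perceived /perceived_of_gain peakE; field.
by rewrite !lt0r_neq0 ?addr_gt0 ?gamma_gt0.
Qed.

Lemma full_budgetE : full_budget B = spending peak.
Proof.
have pk := ltW peak_gt0.
rewrite spending_split// /full_budget full_perceivedE; congr (_ + _).
rewrite -!mulrA; congr (_ * _).
rewrite -(Rintegral_target_gain pk)//; last 2 first.
- exact: continuous_outlay_sub.
- by rewrite outlay0 subr0.
have gE t : full_discount B t = discount_of B (- target_gain peak t).
  rewrite /full_discount /target_gain subrr add0r max_r ?schedule_cost_ge0//.
  rewrite schedule_costE; congr discount_of.
  by have [tts|tts|->] := ltgtP t ts; ring.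
have -> : \int[mu]_(a in `[0, T])
      (outlay (target_gain peak a) - target_gain peak a) =
    \int[mu]_(t in `[0, T]) (db * ((full_discount B t ^+ 2 - al ^+ 2) /
        (2 * full_discount B t))).
  apply: eq_Rintegral => t _.
  by rewrite outlay_sub_discount ?target_gain_ge0// gE.
rewrite RintegralZl//.
(* Factoring [db] out requires the integrability of the quotient, which equals this continuous
   function. *)
have cF : continuous (fun t =>
    db^-1 * (outlay (target_gain peak t) - target_gain peak t)).
  move=> t; apply: cvgM; first exact: cvg_cst.
  apply: (@cvg_comp _ _ _ (target_gain peak) (fun c => outlay c - c)).
    exact: continuous_target_gain.
  exact: continuous_outlay_sub.
apply: eq_integrable (continuous_integrable _ _ cF) => // t _ /=.
congr EFin; rewrite gE outlay_sub_discount ?target_gain_ge0//.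
by rewrite mulKf// lt0r_neq0.
Qed.

End budgets.

Lemma perceived_of_gain_sqrt m : 0 <= m ->
  perceived_of_gain (Num.sqrt (2 * be * ga * m / (s * (be + ga)))) = m.
Proof.
move=> m0; rewrite /perceived_of_gain sqr_sqrtr.
  by field; rewrite !lt0r_neq0 ?addr_gt0 ?gamma_gt0.
have g0 := ltW gamma_gt0; have b0 := ltW beta_gt0; have s0 := ltW capacity_gt0.
by rewrite divr_ge0 ?mulr_ge0 ?addr_ge0.
Qed.

Lemma ler_perceived_of_gain K K' : 0 <= K -> 0 <= K' ->
  (perceived_of_gain K <= perceived_of_gain K') = (K <= K').
Proof.
move=> K0 K'0; have c0 : 0 < s * (be + ga) / (2 * be * ga).
  by rewrite divr_gt0 ?mulr_gt0 ?addr_gt0 ?gamma_gt0.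
by rewrite /perceived_of_gain ![_ * _ ^+ 2 / _]mulrAC ler_pM2l// ler_sqr.
Qed.

(** By [spending_surj], [M] lies in the image of the map, so the generalised inverse returns an [m]
    of the interval with budget [M]; [K] is then read off from [m]. *)
Lemma perceived_of_budgetP M : 0 <= M -> M <= full_budget B ->
  exists K, [/\ 0 <= K <= peak, spending K = M
              & perceived_of_budget B M = perceived_of_gain K].
Proof.
rewrite full_budgetE => M0 MF; set m := perceived_of_budget B M.
have pk := ltW peak_gt0.
have Mim : (budget_of_perceived B @` `[0, full_perceived B])%classic M.
  have [K /andP[K0 Kp] KM] := spending_surj M0 MF.
  exists (perceived_of_gain K); last by rewrite budget_of_perceived_gain.
  rewrite /= in_itv/= full_perceivedE ler_perceived_of_gain// Kp andbT.
  have g0 := ltW gamma_gt0; have b0 := ltW beta_gt0.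
  have s0 := ltW capacity_gt0.
  by rewrite divr_ge0 ?mulr_ge0 ?addr_ge0// sqr_ge0.
have fm : budget_of_perceived B m = M.
  by rewrite /m /perceived_of_budget pinvK// inE.
have : `[0, full_perceived B]%classic m.
  apply: (surjpinv_image_sub (fun y (h : (budget_of_perceived B @`
    `[0, full_perceived B])%classic y) => h)).
  by exists M.
rewrite /= in_itv/= => /andP[m0 mF].
pose K := Num.sqrt (2 * be * ga * m / (s * (be + ga))).
have K0 : 0 <= K by exact: sqrtr_ge0.
have mK : perceived_of_gain K = m by exact: perceived_of_gain_sqrt.
have Kp : K <= peak by rewrite -ler_perceived_of_gain// mK -full_perceivedE.
exists K; split => //; first by rewrite K0.
by rewrite -budget_of_perceived_gain// mK.
Qed.

End model.

(** * Optimal incentive under a monetary budget *)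

Theorem proposition2 (R : realType)
    (N s alpha beta gamma dbar pbar M : R) :
  0 < N -> 0 < s -> 0 < beta -> beta < alpha -> alpha < gamma -> 0 < dbar ->
  let B := Bottleneck N s alpha beta gamma dbar pbar in
  0 <= M -> M <= full_budget B ->
  let m := perceived_of_budget B M in
  let tl := Num.sqrt (2 * gamma * m / (s * beta * (beta + gamma))) in
  let tr := N / s - Num.sqrt (2 * beta * m / (s * gamma * (beta + gamma))) in
  let g := fun t : R => if t <= tl then beta * (t - tl) else gamma * (tr - t) in
  let p := fun t : R =>
    if (tl < t) && (t < tr) then 0
    else alpha - g t / dbar
         + Num.sqrt ((g t / dbar - alpha) ^+ 2 - alpha ^+ 2) in
  exists t' : R, unique (on_time_entry B (fun=> 0)) t' /\
  let t'' := t' + 1 / alpha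
                  * Num.sqrt (2 * beta * gamma * m / (s * (beta + gamma))) in
  let r := fun t : R =>
    if (t <= tl) || (tr <= t) then s
    else if t <= t'' then alpha * s / (alpha - beta)
    else alpha * s / (alpha + gamma) in
  (exists Q : R -> R, optimal B M p r Q) /\
  (forall q r1 Q1 : R -> R, optimal B M q r1 Q1 ->
     forall t, t \in `[0, N / s] -> Num.max (q t) alpha = Num.max (p t) alpha) /\
  (forall r1 Q1 : R -> R, equilibrium B p r1 Q1 ->
     {ae @lebesgue_measure R, forall t, t \in `[0, N / s] -> r1 t = r t}) /\
  unique (on_time_entry B p) t''.
Proof.
move=> N0 s0 b0 ba ag d0 B M0 MF m tl tr g p.
have a0 : 0 < alpha := lt_trans b0 ba.
have g0 : 0 < gamma := lt_trans a0 ag.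
have [K [/andP[K0 Kp] spK mE]] :=
  perceived_of_budgetP (B := B) N0 s0 b0 ba ag d0 M0 MF.
have tlE : tl = congestion_start B K.
  by rewrite /tl /m mE; exact: (left_time_gain (B := B)).
have trE : tr = congestion_end B K.
  by rewrite /tr /m mE; exact: (right_time_gain (B := B)).
(* Outside []tl, tr[], [g] is minus the target gain, so [p] is the discount producing this gain. *)
have pE t : p t = if (tl < t) && (t < tr) then 0
                  else discount_of B (- target_gain B K t).
  rewrite /p; case: ifPn => //; rewrite negb_and -!leNgt => out.
  suff -> : g t = - target_gain B K t by [].
  have be_tl : beta * tl = K.
    by rewrite tlE /congestion_start /= mulrCA divff ?mulr1// lt0r_neq0.
  rewrite /g; case: ifPn => [ttl|]; last rewrite -ltNge => tlt.
    rewrite target_gain_before//= -?tlE//; lra.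
  have {out}trt : tr <= t by case/orP: out => //; rewrite leNgt tlt.
  by rewrite target_gain_after//= -?trE//; lra.
have between t : tl < t -> t < tr -> target_gain B K t = 0.
  by move=> tlt ttr; rewrite target_gain_between// -?tlE -?trE !ltW.
have p_ge0 : discount B p.
  move=> t _; rewrite pE; case: ifPn => // _.
  by rewrite (le_trans (ltW a0))// (discount_of_ge (B := B))// target_gain_ge0.
have gain_p t : 0 <= t <= rush_end B -> gain_at B p t = target_gain B K t.
  move=> _; rewrite /gain_at pE; case: ifPn => [/andP[tlt ttr]|_].
    rewrite max_r ?(ltW a0)// between// /perceived_gain subrr expr0n/=.
    by rewrite mulr0 mul0r.
  rewrite max_l ?(discount_of_ge (B := B)) ?target_gain_ge0//.
  by rewrite perceived_gain_discount_of// target_gain_ge0.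
(* No incentive is the case [K = 0] of the target gain, so the same results yield [t']. *)
have zero_ge0 : discount B (fun=> 0) by move=> t _.
have gain_0 t : 0 <= t <= rush_end B ->
    gain_at B (fun=> 0) t = target_gain B 0 t.
  move=> tT; rewrite /gain_at max_r ?(ltW a0)// /perceived_gain subrr expr0n/=.
  rewrite mulr0 mul0r; apply/eqP; rewrite eq_le target_gain_ge0.
  by rewrite target_gain_inside.
have pk : 0 <= peak B by apply: ltW; exact: peak_gt0.
exists (punctual_entry B 0); split.
  exact: (balanced_on_time (B := B) _ _ _ _ _ _ _ _ zero_ge0 gain_0).
move=> t'' r.
have t''E : t'' = punctual_entry B K.
  have KE : Num.sqrt (2 * beta * gamma * m / (s * (beta + gamma))) = K.
    rewrite /m mE /perceived_of_gain /=.
    have -> : 2 * beta * gamma * (s * (beta + gamma) * K ^+ 2 /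
        (2 * beta * gamma)) / (s * (beta + gamma)) = K ^+ 2.
      by field; rewrite !lt0r_neq0 ?addr_gt0.
    by rewrite sqrtr_sqr ger0_norm.
  by rewrite /t'' KE /punctual_entry /=; field; exact: lt0r_neq0.
have rE : r = balanced_rate B K.
  by apply/funext => t; rewrite /r /balanced_rate tlE trE t''E.
rewrite rE t''E -spK; split; last split; last split.
- by exists (balanced_queue B K); exact: balanced_optimal.
- move=> q r1 Q1 opt t; rewrite in_itv/= => tT.
  exact: (optimal_unique (B := B) _ _ _ _ _ _ _ _ _ _ opt).
- move=> r1 Q1 eqQ.
  exact: (balanced_rate_unique (B := B) _ _ _ _ _ _ _ _ _ _ eqQ).
- exact: (balanced_on_time (B := B)).
Qed.
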